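(* Given a streaming data-string transducer $S$ from $\Sigma$ to $\Sigma$, one can effectively construct a single-pass list-processing program $P$ such that $[\![S]\!]=[\![P]\!]$.
   Context: Fix a totally ordered, possibly infinite, set $D$ of data values, with strict order $<$. A data string over a finite set $\Sigma$ of tags is a finite sequence of pairs in $\Sigma\times D$. SDSTs. A (deterministic) streaming data-string transducer (SDST) from $\Sigma$ to $\Gamma$ consists of: a finite set $Q$ of states; an initial state $q_0$; a finite set $V$ of data variables with a distinguished $curr\in V$; a finite set $X$ of data string variables; a partial output function $O$ from $Q$ to $((\Gamma\times V)\cup X)^*$; a finite set of transitions $(q,\sigma,\varphi,q',\alpha)$ with $q,q'\in Q$, $\sigma\in\Sigma$, $\varphi$ a Boolean formula over atoms $v<curr$, $curr<v$ ($v\in V$), and $\alpha$ mapping $V$ to $V$ and $X$ to $((\Gamma\times V)\cup X)^*$; such that (1) each $x\in X$ occurs at most once in each $O(q)$; (2) for each transition each $x\in X$ occurs at most once in total in the strings $\{\alpha(y)\mid y\in X\}$; (3) distinct transitions with the same source and tag have jointly unsatisfiable tests. A valuation $\beta$ is a partial map sending data variables to $D$, data string variables to data strings over $\Gamma$; tests and strings are evaluated under $\beta$ by substitution and are undefined if some variable occurring in them is undefined. The initial configuration is $(q_0,\beta_0)$ with data variables undefined and data string variables empty. On a symbol $(\sigma,d)$, with $\beta'=\beta[curr\mapsto d]$, a transition $(q,\sigma,\varphi,q',\alpha)$ with $\beta'(\varphi)=1$ gives $(q,\beta)\to(q',\beta'\cdot\alpha)$, where $(\beta'\cdot\alpha)(z)=\beta'(\alpha(z))$.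 If $w$ leads from $(q_0,\beta_0)$ to $(q,\beta)$ and $O(q)$ is defined, $[\![S]\!](w)=\beta(O(q))$; otherwise $[\![S]\!](w)$ is undefined. Single-pass list processing programs. Variables have type bool, tag (values in $\Sigma$), data (values in $D$ or undefined $\bot$), or ref (heap nodes or nil), and are annotated input, output or local. There is exactly one input variable of type ref, named $curr$, and exactly one output variable of type ref; there may be further input/output variables of other types. Output and local variables have initial values: a constant or an input variable of matching type (bool, tag); $\bot$ or an input data variable (data); $curr$ or nil (ref). Data expressions: a data variable or $r.data$ ($r$ of type ref). Tag expressions: a tag variable, a constant of $\Sigma$, or $r.tag$. Reference expressions: a ref variable or nil. Boolean expressions: Boolean combinations of constants 0/1, boolean variables, equality tests between two tag expressions, equality or order tests between two data expressions, and equality tests between two reference expressions. Assignments: of data, tag, boolean expressions to variables of the same type; and reference assignments: (1) $r:=re$; (2) $r.next:=re$; (3) $r:=\mathrm{new}(te,de,re)$; (4) $curr:=curr.next$; where in (1) and (3) $r$ is a local or output ref variable, and $te,de,re$ are tag, data, reference expressions (so $curr:=curr.next$ is the only use of $next$ on a right-hand side). Statements are built from assignments by sequencing, if-then(-else) and while with boolean conditions. A program is a sequence of variable declarations followed by a statement. Program semantics. A configuration consists of a program location (a vertex of the control-flow graph), a data heap (a finite set $N$ of nodes, with a data function $N\to D$, a tag function $N\to\Sigma$, and a next-pointer function $N\to N\cup\{\mathrm{nil}\}$), and the values of the variables. Initially the heap stores the input $(\sigma_1,d_1)\cdots(\sigma_k,d_k)$ as nodes $n_1,\dots,n_k$, with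 $n_i$ storing $(\sigma_i,d_i)$, next-pointer of $n_i$ equal to $n_{i+1}$ for $i<k$ and nil for $i=k$; $curr$ points to $n_1$ (nil if $k=0$), the location is the entry location, and other variables have their input/declared initial values. Execution is the standard deterministic operational semantics; $\mathrm{new}$ adds a fresh node with the given tag, data, next-pointer; executing $r.next:=re$ when $r$ and $curr$ point to the same node is an error (no successor configuration). If execution is infinite or stops at a location other than the unique exit location, the output is undefined. Otherwise the output consists of the final values of the output data/tag/boolean variables and the data string read off the heap from the node referenced by the output ref variable following next-pointers until nil (output undefined if this sequence is infinite). The transduction $[\![P]\!]$. $P$ is viewed as a partial function from data strings to data strings: if $P$ has $k_i$ input and $k_o$ output boolean/data/tag variables, the input data string is prefixed with $k_i$ symbols, each encoding one input argument, and the output data string with $k_o$ symbols, each encoding one output value. In particular, if $k_i=k_o=0$, $[\![P]\!]$ simply maps the input data string to the output data string. *)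

(* Defs.v *)
From HB Require Import structures.
From mathcomp Require Import all_boot all_order.
From Stdlib Require List.

Set Implicit Arguments.
Unset Strict Implicit.
Unset Printing Implicit Defensive.

Definition dstring (Sigma D : Type) := seq (Sigma * D).

(** * Streaming data-string transducers *)

Inductive test (V : Type) :=
  | TTrue
  | TFalse
  | TBelow of V      (* v < curr *)
  | TAbove of V      (* curr < v *)
  | TNot of test V
  | TAnd of test V & test V
  | TOr of test V & test V.
Arguments TTrue {V}.
Arguments TFalse {V}.

(* Elements of ((Gamma x V) u X)^*. *)
Definition pattern (Gamma V X : Type) := seq ((Gamma * V) + X).

Record transition (Sigma Gamma Q V X : finType) := Transition {
  tsrc : Q;
  ttag : Sigma;
  ttest : test V;
  tdst : Q;
  tdata : {ffun V -> V};
  tstr : {ffun X -> pattern Gamma V X} }.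

(* [None] is "undefined". *)
Record valuation (Gamma D V X : Type) := Valuation {
  vdata : V -> option D;
  vstr : X -> option (dstring Gamma D) }.

Section Valuations.
Context {disp : Order.disp_t} {D : orderType disp} {Gamma V X : finType}.
Implicit Types (b : V -> option D) (be : valuation Gamma D V X).

(* Undefined as soon as one variable occurring in the test is undefined. *)
Fixpoint eval_test (curr : V) b (phi : test V) : option bool :=
  match phi with
  | TTrue => Some true
  | TFalse => Some false
  | TBelow v => if (b v, b curr) is (Some x, Some c) then Some (x < c)%O
                else None
  | TAbove v => if (b v, b curr) is (Some x, Some c) then Some (c < x)%O
                else None
  | TNot p => omap negb (eval_test curr b p)
  | TAnd p q => if (eval_test curr b p, eval_test curr b q)
                  is (Some x, Some y) then Some (x && y) else None
  | TOr p q => if (eval_test curr b p, eval_test curr b q)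
                  is (Some x, Some y) then Some (x || y) else None
  end.

Definition eval_item be (i : (Gamma * V) + X) : option (dstring Gamma D) :=
  match i with
  | inl (g, v) => omap (fun d => [:: (g, d)]) (vdata be v)
  | inr x => vstr be x
  end.

Fixpoint eval_pattern be (s : pattern Gamma V X) : option (dstring Gamma D) :=
  if s is i :: s' then
    if (eval_item be i, eval_pattern be s') is (Some u, Some u')
    then Some (u ++ u') else None
  else Some [::].

Definition set_curr (curr : V) be (d : D) : valuation Gamma D V X :=
  Valuation [eta vdata be with curr |-> Some d] (vstr be).

Definition init_valuation : valuation Gamma D V X :=
  Valuation (fun=> None) (fun=> Some [::]).

End Valuations.

(* The data domain [D] is a parameter of the type of transducers because joint
   unsatisfiability of tests depends on the order of [D]. The list [trans]
   represents the finite set of its members. *)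
Record sdst (disp : Order.disp_t) (D : orderType disp) (Sigma Gamma : finType) :=
  SDST {
  state : finType;
  start : state;
  datavar : finType;
  curr : datavar;
  strvar : finType;
  output : {ffun state -> option (pattern Gamma datavar strvar)};
  trans : seq (transition Sigma Gamma state datavar strvar);
  output_copyless : forall q s, output q = Some s ->
    forall x : strvar, count_mem (inr x) s <= 1;
  trans_copyless : forall t, List.In t trans ->
    forall x : strvar, \sum_(y : strvar) count_mem (inr x) (tstr t y) <= 1;
  trans_deterministic : forall t1 t2,
    List.In t1 trans -> List.In t2 trans -> t1 <> t2 ->
    tsrc t1 = tsrc t2 -> ttag t1 = ttag t2 ->
    forall b : datavar -> option D,
      ~ (eval_test curr b (ttest t1) = Some true /\
         eval_test curr b (ttest t2) = Some true) }.

Section SDSTSemantics.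
Context {disp : Order.disp_t} {D : orderType disp} {Sigma Gamma : finType}.
Variable S : sdst D Sigma Gamma.

Definition sdst_val := valuation Gamma D (datavar S) (strvar S).

Definition apply_trans (be : sdst_val)
    (t : transition Sigma Gamma (state S) (datavar S) (strvar S)) : sdst_val :=
  Valuation (fun v => vdata be (tdata t v)) (fun x => eval_pattern be (tstr t x)).

Inductive sdst_run : state S -> sdst_val -> dstring Sigma D ->
                     state S -> sdst_val -> Prop :=
  | RunNil q be : sdst_run q be [::] q be
  | RunCons be sigma d w t q' be' :
      List.In t (trans S) ->
      ttag t = sigma ->
      eval_test (curr S) (vdata (set_curr (curr S) be d)) (ttest t) = Some true ->
      sdst_run (tdst t) (apply_trans (set_curr (curr S) be d) t) w q' be' ->
      sdst_run (tsrc t) be ((sigma, d) :: w) q' be'.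

(* The graph of the partial function [[S]]. *)
Definition sdst_sem (w : dstring Sigma D) (w' : dstring Gamma D) : Prop :=
  exists q be s,
    [/\ sdst_run (start S) init_valuation w q be,
        output S q = Some s & eval_pattern be s = Some w'].

End SDSTSemantics.

(** * Single-pass list-processing programs *)

(* The variables of each type. The input reference variable [curr] is not
   listed: it is present in every program. *)
Record signature := Signature {
  bvar : finType;
  tvar : finType;
  dvar : finType;
  rvar : finType }.

Inductive refvar (G : signature) := RCurr | RVar of rvar G.
Arguments RCurr {G}.

Inductive dexp (G : signature) := DVar of dvar G | DataOf of refvar G.

Inductive texp (Sigma : finType) (G : signature) :=
  | TVar of tvar G
  | TConst of Sigma
  | TagOf of refvar G.

Inductive rexp (G : signature) := RRef of refvar G | RNil.
Arguments RNil {G}.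

Inductive bexp (Sigma : finType) (G : signature) :=
  | BConst of bool
  | BVar of bvar G
  | BTagEq of texp Sigma G & texp Sigma G
  | BDataEq of dexp G & dexp G
  | BDataLt of dexp G & dexp G
  | BRefEq of rexp G & rexp G
  | BNot of bexp Sigma G
  | BAnd of bexp Sigma G & bexp Sigma G
  | BOr of bexp Sigma G & bexp Sigma G.

(* [SetRef] and [New] cannot assign [curr]; [Advance] is curr := curr.next. *)
Inductive assignment (Sigma : finType) (G : signature) :=
  | SetBool of bvar G & bexp Sigma G
  | SetTag of tvar G & texp Sigma G
  | SetData of dvar G & dexp G
  | SetRef of rvar G & rexp G
  | SetNext of refvar G & rexp G
  | New of rvar G & texp Sigma G & dexp G & rexp G
  | Advance.
Arguments Advance {Sigma G}.

Inductive stmt (Sigma : finType) (G : signature) :=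
  | Assign of assignment Sigma G
  | Seq of stmt Sigma G & stmt Sigma G
  | IfThen of bexp Sigma G & stmt Sigma G
  | IfThenElse of bexp Sigma G & stmt Sigma G & stmt Sigma G
  | While of bexp Sigma G & stmt Sigma G.

(* The annotation of a variable; [Init] is the type of initializers. *)
Inductive annot (Init : Type) := Input | Output of Init | Local of Init.
Arguments Input {Init}.

Definition initializer Init (a : annot Init) : option Init :=
  match a with Input => None | Output i | Local i => Some i end.
Definition is_input Init (a : annot Init) :=
  if a is Input then true else false.
Definition is_output Init (a : annot Init) :=
  if a is Output _ then true else false.

Inductive rinit := InitCurr | InitNil.

(* An initializer [inr y] or [Some y] is the input variable [y]; the initializer
   [None] of a data variable is bottom. The reference variable [prout] is the
   output one, all the others are local. *)
Record program (Sigma : finType) := Program {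
  psig : signature;
  bdecl : {ffun bvar psig -> annot (bool + bvar psig)};
  tdecl : {ffun tvar psig -> annot (Sigma + tvar psig)};
  ddecl : {ffun dvar psig -> annot (option (dvar psig))};
  rdecl : {ffun rvar psig -> rinit};
  prout : rvar psig;
  body : stmt Sigma psig;
  bdecl_input : forall x y,
    initializer (bdecl x) = Some (inr y) -> is_input (bdecl y);
  tdecl_input : forall x y,
    initializer (tdecl x) = Some (inr y) -> is_input (tdecl y);
  ddecl_input : forall x y,
    initializer (ddecl x) = Some (Some y) -> is_input (ddecl y) }.

(* Heap nodes are the positions of a sequence of cells; [None] is nil. *)
Definition pointer := option nat.

Record cell (Sigma D : Type) := Cell {
  ctag : Sigma;
  cdata : D;
  cnext : pointer }.

Definition heap (Sigma D : Type) := seq (cell Sigma D).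

Record store (Sigma D : Type) (G : signature) := Store {
  bval : bvar G -> bool;
  tval : tvar G -> Sigma;
  dval : dvar G -> option D;
  rval : rvar G -> pointer;
  cval : pointer }.

Section Eval.
Context {disp : Order.disp_t} {D : orderType disp} {Sigma : finType}.
Context {G : signature}.
Variables (h : heap Sigma D) (s : store Sigma D G).

(* Evaluation returns [None] on an execution error: dereferencing nil, or
   testing an undefined data value. *)

Definition deref (p : pointer) : option (cell Sigma D) := obind (onth h) p.

Definition eval_refvar (r : refvar G) : pointer :=
  match r with RCurr => cval s | RVar x => rval s x end.

Definition eval_rexp (e : rexp G) : pointer :=
  match e with RRef r => eval_refvar r | RNil => None end.

(* [Some None] is the value bottom. *)
Definition eval_dexp (e : dexp G) : option (option D) :=
  match e with
  | DVar x => Some (dval s x)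
  | DataOf r => omap (fun c => Some (cdata c)) (deref (eval_refvar r))
  end.

Definition eval_texp (e : texp Sigma G) : option Sigma :=
  match e with
  | TVar x => Some (tval s x)
  | TConst t => Some t
  | TagOf r => omap (@ctag _ _) (deref (eval_refvar r))
  end.

Definition eval_dcmp (cmp : rel D) (e1 e2 : dexp G) : option bool :=
  if (eval_dexp e1, eval_dexp e2) is (Some (Some x), Some (Some y))
  then Some (cmp x y) else None.

Fixpoint eval_bexp (e : bexp Sigma G) : option bool :=
  match e with
  | BConst b => Some b
  | BVar x => Some (bval s x)
  | BTagEq e1 e2 => if (eval_texp e1, eval_texp e2) is (Some x, Some y)
                    then Some (x == y) else None
  | BDataEq e1 e2 => eval_dcmp eq_op e1 e2
  | BDataLt e1 e2 => eval_dcmp <%O e1 e2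
  | BRefEq e1 e2 => Some (eval_rexp e1 == eval_rexp e2)
  | BNot e1 => omap negb (eval_bexp e1)
  | BAnd e1 e2 => if (eval_bexp e1, eval_bexp e2) is (Some x, Some y)
                  then Some (x && y) else None
  | BOr e1 e2 => if (eval_bexp e1, eval_bexp e2) is (Some x, Some y)
                 then Some (x || y) else None
  end.

Definition set_bval x b :=
  Store [eta bval s with x |-> b] (tval s) (dval s) (rval s) (cval s).
Definition set_tval x t :=
  Store (bval s) [eta tval s with x |-> t] (dval s) (rval s) (cval s).
Definition set_dval x d :=
  Store (bval s) (tval s) [eta dval s with x |-> d] (rval s) (cval s).
Definition set_rval x p :=
  Store (bval s) (tval s) (dval s) [eta rval s with x |-> p] (cval s).
Definition set_cval p :=
  Store (bval s) (tval s) (dval s) (rval s) p.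

Definition exec (a : assignment Sigma G) : option (heap Sigma D * store Sigma D G) :=
  match a with
  | SetBool x e => omap (fun b => (h, set_bval x b)) (eval_bexp e)
  | SetTag x e => omap (fun t => (h, set_tval x t)) (eval_texp e)
  | SetData x e => omap (fun d => (h, set_dval x d)) (eval_dexp e)
  | SetRef x e => Some (h, set_rval x (eval_rexp e))
  | SetNext r e =>
      if eval_refvar r is Some n then
        if cval s == Some n then None else
        omap (fun c => (set_nth c h n (Cell (ctag c) (cdata c) (eval_rexp e)), s))
             (onth h n)
      else None
  | New x te de re =>
      if (eval_texp te, eval_dexp de) is (Some t, Some (Some d)) then
        Some (rcons h (Cell t d (eval_rexp re)), set_rval x (Some (size h)))
      else None
  | Advance => omap (fun c => (h, set_cval (cnext c))) (deref (cval s))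
  end.

End Eval.

(* A program location is given by the statements that remain to be executed
   from it; the exit location is [[::]]. *)
Record config (Sigma : finType) (D : Type) (G : signature) := Config {
  location : seq (stmt Sigma G);
  cheap : heap Sigma D;
  cstore : store Sigma D G }.

Section ProgramSemantics.
Context {disp : Order.disp_t} {D : orderType disp} {Sigma : finType}.

(* [None]: no successor configuration. *)
Definition step (G : signature) (c : config Sigma D G) :
    option (config Sigma D G) :=
  let: Config loc h s := c in
  match loc with
  | [::] => None
  | Assign a :: k => omap (fun hs => Config k hs.1 hs.2) (exec h s a)
  | Seq s1 s2 :: k => Some (Config [:: s1, s2 & k] h s)
  | IfThen e s1 :: k =>
      omap (fun b : bool => Config (if b then s1 :: k else k) h s)
           (eval_bexp h s e)
  | IfThenElse e s1 s2 :: k =>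
      omap (fun b : bool => Config ((if b then s1 else s2) :: k) h s)
           (eval_bexp h s e)
  | While e s1 :: k =>
      omap (fun b : bool => Config (if b then [:: s1, While e s1 & k] else k) h s)
           (eval_bexp h s e)
  end.

Definition reaches (G : signature) (c c' : config Sigma D G) : Prop :=
  exists n, iter n (obind (@step G)) (Some c) = Some c'.

Definition input_heap (w : dstring Sigma D) : heap Sigma D :=
  [seq Cell x.1.1 x.1.2 (if x.2 < size w then Some x.2 else None)
     | x <- zip w (iota 1 (size w))].

Definition input_curr (w : dstring Sigma D) : pointer :=
  if w is [::] then None else Some 0.

Inductive list_at (h : heap Sigma D) : pointer -> dstring Sigma D -> Prop :=
  | ListNil : list_at h None [::]
  | ListCons n c w : onth h n = Some c -> list_at h (cnext c) w ->
      list_at h (Some n) ((ctag c, cdata c) :: w).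

(* How bool, tag and data values are represented by symbols of a data string.
   Representations are partial, since [Sigma * D] may have a single element. *)
Definition partial_injective (A B : Type) (f : A -> option B) : Prop :=
  forall x y z, f x = Some z -> f y = Some z -> x = y.

Record io_encoding := IOEncoding {
  enc_bool : bool -> option (Sigma * D);
  enc_tag : Sigma -> option (Sigma * D);
  enc_data : option D -> option (Sigma * D);
  enc_bool_inj : partial_injective enc_bool;
  enc_tag_inj : partial_injective enc_tag;
  enc_data_inj : partial_injective enc_data }.

Variables (E : io_encoding) (P : program Sigma).

(* Only the values at input variables matter. *)
Record inputs := Inputs {
  in_bool : bvar (psig P) -> bool;
  in_tag : tvar (psig P) -> Sigma;
  in_data : dvar (psig P) -> option D }.

Definition init_store (a : inputs) (w : dstring Sigma D) :
    store Sigma D (psig P) :=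
  Store
    (fun x => match initializer (bdecl P x) with
              | None => in_bool a x
              | Some (inl b) => b
              | Some (inr y) => in_bool a y
              end)
    (fun x => match initializer (tdecl P x) with
              | None => in_tag a x
              | Some (inl t) => t
              | Some (inr y) => in_tag a y
              end)
    (fun x => match initializer (ddecl P x) with
              | None => in_data a x
              | Some None => None
              | Some (Some y) => in_data a y
              end)
    (fun x => match rdecl P x with
              | InitCurr => input_curr w
              | InitNil => None
              end)
    (input_curr w).

Definition init_config (a : inputs) (w : dstring Sigma D) :=
  Config [:: body P] (input_heap w) (init_store a w).

(* Input and output arguments are listed by type: bool, tag, data. *)
Definition enc_inputs (a : inputs) : seq (option (Sigma * D)) :=
  [seq enc_bool E (in_bool a x) | x <- enum (bvar (psig P)) & is_input (bdecl P x)]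
  ++ [seq enc_tag E (in_tag a x) | x <- enum (tvar (psig P)) & is_input (tdecl P x)]
  ++ [seq enc_data E (in_data a x) | x <- enum (dvar (psig P)) & is_input (ddecl P x)].

Definition enc_outputs (s : store Sigma D (psig P)) : seq (option (Sigma * D)) :=
  [seq enc_bool E (bval s x) | x <- enum (bvar (psig P)) & is_output (bdecl P x)]
  ++ [seq enc_tag E (tval s x) | x <- enum (tvar (psig P)) & is_output (tdecl P x)]
  ++ [seq enc_data E (dval s x) | x <- enum (dvar (psig P)) & is_output (ddecl P x)].

(* The graph of the partial function [[P]]. *)
Definition program_sem (w w' : dstring Sigma D) : Prop :=
  exists (a : inputs) (pre u post v : dstring Sigma D) h s,
    [/\ w = pre ++ u /\ map Some pre = enc_inputs a,
        reaches (init_config a u) (Config [::] h s),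
        list_at h (rval s (prout P)) v &
        w' = post ++ v /\ map Some post = enc_outputs s].

End ProgramSemantics.
Arguments io_encoding {disp} D Sigma.

(** * Effectivity

    A Turing-complete language over binary trees (the WHILE language of
    N. Jones, in combinator form), and finite descriptions of transducers and
    programs as trees. *)

Inductive tree := Leaf | Node of tree & tree.

Inductive algorithm :=
  | AId
  | ALeaf
  | ALeft
  | ARight
  | APair of algorithm & algorithm
  | AComp of algorithm & algorithm                  (* AComp f g = g after f *)
  | AIf of algorithm & algorithm & algorithm
  | AWhile of algorithm & algorithm.

Definition lchild (t : tree) := if t is Node l _ then l else Leaf.
Definition rchild (t : tree) := if t is Node _ r then r else Leaf.

(* [computes e t t']: [e] halts on [t] with result [t']; [Leaf] is false. *)
Inductive computes : algorithm -> tree -> tree -> Prop :=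
  | CId t : computes AId t t
  | CLeaf t : computes ALeaf t Leaf
  | CLeft t : computes ALeft t (lchild t)
  | CRight t : computes ARight t (rchild t)
  | CPair f g t l r : computes f t l -> computes g t r ->
      computes (APair f g) t (Node l r)
  | CComp f g t u v : computes f t u -> computes g u v ->
      computes (AComp f g) t v
  | CIfTrue c f g t l r u : computes c t (Node l r) -> computes f t u ->
      computes (AIf c f g) t u
  | CIfFalse c f g t u : computes c t Leaf -> computes g t u ->
      computes (AIf c f g) t u
  | CWhileTrue c f t l r u v : computes c t (Node l r) -> computes f t u ->
      computes (AWhile c f) u v -> computes (AWhile c f) t v
  | CWhileFalse c f t : computes c t Leaf -> computes (AWhile c f) t t.

Definition code_nat (n : nat) : tree := iter n (Node Leaf) Leaf.
Definition code_seq (A : Type) (f : A -> tree) (s : seq A) : tree :=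
  foldr (fun x t => Node (f x) t) Leaf s.
Definition code_option (A : Type) (f : A -> tree) (o : option A) : tree :=
  if o is Some x then Node (f x) Leaf else Leaf.
Definition code_elt (T : finType) (x : T) : tree := code_nat (enum_rank x).
Definition code_fun (T : finType) (A : Type) (f : A -> tree) (g : T -> A) : tree :=
  code_seq (fun x => f (g x)) (enum T).
(* The [k]-th constructor of an inductive type, with its arguments. *)
Definition code_cons (k : nat) (args : seq tree) : tree :=
  Node (code_nat k) (code_seq id args).
Definition code_sum (A B : Type) (f : A -> tree) (g : B -> tree) (x : A + B) :=
  match x with inl a => code_cons 0 [:: f a] | inr b => code_cons 1 [:: g b] end.
Definition code_bool (b : bool) : tree := code_nat b.

Section CodeSDST.
Context {disp : Order.disp_t} {D : orderType disp} {Sigma Gamma : finType}.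

Fixpoint code_test (V : finType) (phi : test V) : tree :=
  match phi with
  | TTrue => code_cons 0 [::]
  | TFalse => code_cons 1 [::]
  | TBelow v => code_cons 2 [:: code_elt v]
  | TAbove v => code_cons 3 [:: code_elt v]
  | TNot p => code_cons 4 [:: code_test p]
  | TAnd p q => code_cons 5 [:: code_test p; code_test q]
  | TOr p q => code_cons 6 [:: code_test p; code_test q]
  end.

Definition code_pattern (V X : finType) (s : pattern Gamma V X) : tree :=
  code_seq
    (code_sum (fun gv => Node (code_elt gv.1) (code_elt gv.2)) (@code_elt X)) s.

Definition code_transition (Q V X : finType)
    (t : transition Sigma Gamma Q V X) : tree :=
  code_seq id
    [:: code_elt (tsrc t); code_elt (ttag t); code_test (ttest t);
        code_elt (tdst t); code_fun (@code_elt V) (tdata t);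
        code_fun (@code_pattern V X) (tstr t)].

Definition code_sdst (S : sdst D Sigma Gamma) : tree :=
  code_seq id
    [:: code_nat #|Sigma|; code_nat #|Gamma|;
        code_nat #|state S|; code_elt (start S);
        code_nat #|datavar S|; code_elt (curr S);
        code_nat #|strvar S|;
        code_fun (code_option (@code_pattern (datavar S) (strvar S))) (output S);
        code_seq (@code_transition (state S) (datavar S) (strvar S)) (trans S)].

End CodeSDST.

Section CodeProgram.
Context {Sigma : finType}.

Section Syntax.
Context {G : signature}.

Definition code_refvar (r : refvar G) : tree :=
  match r with
  | RCurr => code_cons 0 [::]
  | RVar x => code_cons 1 [:: code_elt x]
  end.

Definition code_dexp (e : dexp G) : tree :=
  match e with
  | DVar x => code_cons 0 [:: code_elt x]
  | DataOf r => code_cons 1 [:: code_refvar r]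
  end.

Definition code_texp (e : texp Sigma G) : tree :=
  match e with
  | TVar x => code_cons 0 [:: code_elt x]
  | TConst t => code_cons 1 [:: code_elt t]
  | TagOf r => code_cons 2 [:: code_refvar r]
  end.

Definition code_rexp (e : rexp G) : tree :=
  match e with
  | RRef r => code_cons 0 [:: code_refvar r]
  | RNil => code_cons 1 [::]
  end.

Fixpoint code_bexp (e : bexp Sigma G) : tree :=
  match e with
  | BConst b => code_cons 0 [:: code_bool b]
  | BVar x => code_cons 1 [:: code_elt x]
  | BTagEq e1 e2 => code_cons 2 [:: code_texp e1; code_texp e2]
  | BDataEq e1 e2 => code_cons 3 [:: code_dexp e1; code_dexp e2]
  | BDataLt e1 e2 => code_cons 4 [:: code_dexp e1; code_dexp e2]
  | BRefEq e1 e2 => code_cons 5 [:: code_rexp e1; code_rexp e2]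
  | BNot e1 => code_cons 6 [:: code_bexp e1]
  | BAnd e1 e2 => code_cons 7 [:: code_bexp e1; code_bexp e2]
  | BOr e1 e2 => code_cons 8 [:: code_bexp e1; code_bexp e2]
  end.

Definition code_assignment (a : assignment Sigma G) : tree :=
  match a with
  | SetBool x e => code_cons 0 [:: code_elt x; code_bexp e]
  | SetTag x e => code_cons 1 [:: code_elt x; code_texp e]
  | SetData x e => code_cons 2 [:: code_elt x; code_dexp e]
  | SetRef x e => code_cons 3 [:: code_elt x; code_rexp e]
  | SetNext r e => code_cons 4 [:: code_refvar r; code_rexp e]
  | New x te de re =>
      code_cons 5 [:: code_elt x; code_texp te; code_dexp de; code_rexp re]
  | Advance => code_cons 6 [::]
  end.

Fixpoint code_stmt (s : stmt Sigma G) : tree :=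
  match s with
  | Assign a => code_cons 0 [:: code_assignment a]
  | Seq s1 s2 => code_cons 1 [:: code_stmt s1; code_stmt s2]
  | IfThen e s1 => code_cons 2 [:: code_bexp e; code_stmt s1]
  | IfThenElse e s1 s2 => code_cons 3 [:: code_bexp e; code_stmt s1; code_stmt s2]
  | While e s1 => code_cons 4 [:: code_bexp e; code_stmt s1]
  end.

End Syntax.

Definition code_annot (Init : Type) (f : Init -> tree) (a : annot Init) : tree :=
  match a with
  | Input => code_cons 0 [::]
  | Output i => code_cons 1 [:: f i]
  | Local i => code_cons 2 [:: f i]
  end.

Definition code_rinit (i : rinit) : tree :=
  match i with InitCurr => code_cons 0 [::] | InitNil => code_cons 1 [::] end.

Definition code_program (P : program Sigma) : tree :=
  code_seq id
    [:: code_nat #|bvar (psig P)|; code_nat #|tvar (psig P)|;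
        code_nat #|dvar (psig P)|; code_nat #|rvar (psig P)|;
        code_fun (code_annot (code_sum code_bool (@code_elt _))) (bdecl P);
        code_fun (code_annot (code_sum (@code_elt _) (@code_elt _))) (tdecl P);
        code_fun (code_annot (code_option (@code_elt _))) (ddecl P);
        code_fun code_rinit (rdecl P);
        code_elt (prout P);
        code_stmt (body P)].

End CodeProgram.

(* Main.v *)
Require Import Defs.
From mathcomp Require Import all_boot all_order.
From Stdlib Require Import Classical.
From Stdlib Require List.

(** The program stores the value of a string variable as a linked list of fresh
    nodes, with pointers to its first and last nodes, so that concatenation is
    a few assignments. As the transducer is copyless, a round uses each list at
    most once: the new values are built destructively in scratch variables, and
    a list is emptied when it is appended to another one. Boolean variables
    record the state and which variables are defined, and the program commits an
    execution error when no transition is enabled or when the output is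
    undefined.

    The compiler is a composition of structural recursions on trees; each of
    them is run by a single while loop with an explicit stack. *)

Set Implicit Arguments.
Unset Strict Implicit.
Unset Printing Implicit Defensive.

(** * Total tree functions computed by algorithms *)

(** An undefined variable of the transducer is harmless until a test or the output uses it, whereas
    a program fails as soon as it compares or stores an undefined data value. Definedness therefore
    has to be simulated by flags, which also separate an undefined string from the empty one, whose
    pointers are nil. Scratch variables are needed because the assignments of a transition are
    simultaneous, and fresh nodes because redirecting the node of [curr] is an error. Both semantics
    are deterministic. So it suffices to construct, for each input, an execution that yields the
    output of the transducer, or one that gets stuck away from the exit when there is no output; no
    execution has to be analysed backwards. An algorithm sees an element of a finite type only as
    its rank. The variable types of the generated program are sums and options of those of the
    transducer, so that their ranks are obtained by additions. *)

Definition computable (f : tree -> tree) : Prop :=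
  exists a, forall t, computes a t (f t).

Lemma computable_id : computable (fun t => t).
Proof. by exists AId => t; apply: CId. Qed.

Lemma computable_comp f g :
  computable f -> computable g -> computable (fun t => g (f t)).
Proof. by move=> [a ca] [b cb]; exists (AComp a b) => t; apply: CComp. Qed.

Lemma computable_node f g :
  computable f -> computable g -> computable (fun t => Node (f t) (g t)).
Proof. by move=> [a ca] [b cb]; exists (APair a b) => t; apply: CPair. Qed.

Lemma computable_const c : computable (fun=> c).
Proof.
elim: c => [|l [a ca] r [b cb]]; first by exists ALeaf => t; apply: CLeaf.
by exists (APair a b) => t; apply: CPair.
Qed.

Lemma computable_lchild f : computable f -> computable (fun t => lchild (f t)).
Proof.
by move=> cf; apply: (computable_comp cf); exists ALeft => t; apply: CLeft.
Qed.

Lemma computable_rchild f : computable f -> computable (fun t => rchild (f t)).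
Proof.
by move=> cf; apply: (computable_comp cf); exists ARight => t; apply: CRight.
Qed.

Definition condT (c t u : tree) := if c is Node _ _ then t else u.

Lemma computable_if c f g : computable c -> computable f -> computable g ->
  computable (fun t => condT (c t) (f t) (g t)).
Proof.
move=> [ac cc] [af cf] [ag cg]; exists (AIf ac af ag) => t.
case E: (c t) (cc t) => [|l r] ct; first exact: CIfFalse ct (cg t).
exact: CIfTrue ct (cf t).
Qed.

Create HintDb comp.
#[local] Hint Resolve computable_id computable_node computable_const
  computable_lchild computable_rchild computable_if : comp.

Ltac comp := auto 100 with comp.

(** Primitive recursion: [g] sees the subtrees as well as the results on them. The environment [e]
    stays constant, which allows the while loop to keep a single copy of it. *)
Fixpoint recT (z : tree -> tree) (g : tree -> tree -> tree -> tree -> tree -> tree)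
    (e t : tree) : tree :=
  if t is Node l r then g e l r (recT z g e l) (recT z g e r) else z e.

Section TreeRecursion.
Variables (z : tree -> tree) (g : tree -> tree -> tree -> tree -> tree -> tree).
Hypothesis cz : computable z.
Hypothesis cg : computable (fun p => g (lchild p) (lchild (rchild p))
  (lchild (rchild (rchild p))) (lchild (rchild (rchild (rchild p))))
  (rchild (rchild (rchild (rchild p))))).

(* The state is [Node e (Node agenda results)]; the agenda lists the subtrees
   still to be visited (flag [Leaf]) and the nodes whose two recursive results
   are on top of the stack of results (flag [Node Leaf Leaf]). *)
Let visit t := Node Leaf t.
Let build t := Node (Node Leaf Leaf) t.

Definition recT_step (st : tree) : tree :=
  let e := lchild st in let agenda := lchild (rchild st) in
  let res := rchild (rchild st) in
  let t := rchild (lchild agenda) in let rest := rchild agenda in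
  condT (lchild (lchild agenda))
    (Node e (Node rest
      (* The right subtree is visited last, so its result lies above that of the left one. *)
      (Node (g e (lchild t) (rchild t) (lchild (rchild res)) (lchild res))
            (rchild (rchild res)))))
    (condT t
      (Node e (Node
        (Node (visit (lchild t)) (Node (visit (rchild t)) (Node (build t) rest)))
        res))
      (Node e (Node rest (Node (z e) res)))).

Lemma computable_recT_step : computable recT_step.
Proof.
rewrite /recT_step /visit /build.
have cz' f : computable f -> computable (fun t => z (f t)).
  by move=> cf; apply: computable_comp cf cz.
have cg' f1 f2 f3 f4 f5 : computable f1 -> computable f2 -> computable f3 ->
    computable f4 -> computable f5 ->
    computable (fun t => g (f1 t) (f2 t) (f3 t) (f4 t) (f5 t)).
  move=> c1 c2 c3 c4 c5.
  pose p t := Node (f1 t) (Node (f2 t) (Node (f3 t) (Node (f4 t) (f5 t)))).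
  have cp : computable p by rewrite /p; comp.
  exact: computable_comp cp cg.
by comp.
Qed.

Lemma computable_recT_uncurried :
  computable (fun p => recT z g (lchild p) (rchild p)).
Proof.
have [a ca] := computable_recT_step.
have [c cc] : computable (fun st => lchild (rchild st)) by comp.
have more e x rest res u :
    computes (AWhile c a) (recT_step (Node e (Node (Node x rest) res))) u ->
    computes (AWhile c a) (Node e (Node (Node x rest) res)) u.
  move=> cu; apply: CWhileTrue (ca _) cu.
  exact: (cc (Node e (Node (Node x rest) res))).
(* The invariant in continuation form: the run with [t] still to visit is reduced to the run with
   its result already pushed. The agenda and the stack are arbitrary, as the two subtrees are met
   under different ones. *)
have visitP e t rest res u :
    computes (AWhile c a) (Node e (Node rest (Node (recT z g e t) res))) u ->
    computes (AWhile c a) (Node e (Node (Node (visit t) rest) res)) u.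
  elim: t rest res => [|l IHl r IHr] rest res cu; first exact: more.
  by apply/more/IHl/IHr/more.
have [ai ci] : computable (fun p =>
    Node (lchild p) (Node (Node (visit (rchild p)) Leaf) Leaf)).
  by rewrite /visit; comp.
have [ao co] : computable (fun st => lchild (rchild (rchild st))) by comp.
exists (AComp ai (AComp (AWhile c a) ao)) => p.
apply: CComp (ci p) _.
apply: (CComp (u := Node (lchild p)
          (Node Leaf (Node (recT z g (lchild p) (rchild p)) Leaf)))); last exact: co.
exact/visitP/CWhileFalse/cc.
Qed.

Lemma computable_recT e t : computable e -> computable t ->
  computable (fun p => recT z g (e p) (t p)).
Proof.
by move=> ce ct;
  apply: (computable_comp (computable_node ce ct) computable_recT_uncurried).
Qed.

End TreeRecursion.

(** Coded lists are right spines and coded numbers are lists of leaves, so one fold serves for both;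
    the recursive result on the left child is dropped. *)
Definition foldT (z : tree -> tree) (g : tree -> tree -> tree -> tree) :=
  recT z (fun e x _ _ acc => g e x acc).

Lemma computable_foldT z g e t : computable z ->
  computable (fun p => g (lchild p) (lchild (rchild p)) (rchild (rchild p))) ->
  computable e -> computable t -> computable (fun p => foldT z g (e p) (t p)).
Proof.
move=> cz cg; apply: computable_recT => //.
pose q p := Node (lchild p) (Node (lchild (rchild p))
  (rchild (rchild (rchild (rchild p))))).
have cq : computable q by rewrite /q; comp.
exact: computable_comp cq cg.
Qed.

Lemma foldT_code_seq A (c : A -> tree) z g e (s : seq A) :
  foldT z g e (code_seq c s) = foldr (fun x => g e (c x)) (z e) s.
Proof. by elim: s => //= x s <-. Qed.

(** * Arithmetic and tables *)

Definition addT (m n : tree) := foldT id (fun _ => Node) n m.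

Lemma computable_addT m n : computable m -> computable n ->
  computable (fun p => addT (m p) (n p)).
Proof. by move=> cm cn; apply: computable_foldT => //; comp. Qed.

Lemma addT_code m n : addT (code_nat m) (code_nat n) = code_nat (m + n).
Proof. by elim: m => //= m <-. Qed.

Definition nseqT (c n : tree) := foldT (fun=> Leaf) (fun c _ => Node c) c n.

Lemma computable_nseqT c n : computable c -> computable n ->
  computable (fun p => nseqT (c p) (n p)).
Proof. by move=> cc cn; apply: computable_foldT => //; comp. Qed.

Lemma nseqT_code A (c : tree) (s : seq A) :
  nseqT c (code_nat (size s)) = code_seq (fun=> c) s.
Proof. by elim: s => //= x s <-. Qed.

Definition mapST (s : tree) :=
  foldT (fun=> Leaf) (fun _ x => Node (Node Leaf x)) Leaf s.

Lemma computable_mapST s : computable s -> computable (fun p => mapST (s p)).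
Proof. by move=> cs; apply: computable_foldT => //; comp. Qed.

Definition iotaT (n : tree) :=
  foldT (fun=> Leaf) (fun _ _ s => Node Leaf (mapST s)) Leaf n.

Lemma computable_iotaT n : computable n -> computable (fun p => iotaT (n p)).
Proof.
by move=> cn; apply: computable_foldT => //; comp;
   apply: computable_node; comp; apply: computable_mapST; comp.
Qed.

Lemma iotaT_code n : iotaT (code_nat n) = code_seq code_nat (iota 0 n).
Proof.
elim: n => //= n IHn.
rewrite -[LHS]/(Node Leaf (mapST (iotaT (code_nat n)))) IHn; congr Node.
rewrite (iotaDl 1 0) /mapST foldT_code_seq.
by elim: (iota 0 n) => //= m s ->.
Qed.

Definition nthT (s n : tree) := lchild (foldT id (fun _ _ => rchild) s n).

Lemma computable_nthT s n : computable s -> computable n ->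
  computable (fun p => nthT (s p) (n p)).
Proof. by move=> cs cn; apply/computable_lchild/computable_foldT => //; comp. Qed.

#[local] Hint Resolve computable_addT computable_nseqT computable_iotaT
  computable_nthT : comp.

Lemma enum_rank_index (T : finType) (x : T) :
  enum_rank x = index x (enum T) :> nat.
Proof.
by rewrite -{2}[x]enum_rankK (enum_val_nth x) index_uniq ?enum_uniq // -cardE ltn_ord.
Qed.

Lemma iotaT_enum (T : finType) :
  iotaT (code_nat #|T|) = code_seq (@code_elt T) (enum T).
Proof.
rewrite iotaT_code; have <- : [seq val (enum_rank x) | x <- enum T] = iota 0 #|T|.
  apply: (@eq_from_nth _ 0) => [|i]; first by rewrite size_map size_iota cardE.
  rewrite size_map => lti; have [x0 _] : exists x0, x0 \in enum T.
    by case: (enum T) lti => // x0 s _; exists x0; rewrite mem_head.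
  rewrite (nth_map x0) // nth_iota ?cardE // [LHS]enum_rank_index.
  by rewrite index_uniq ?enum_uniq.
by elim: (enum T) => //= x s ->.
Qed.

(** A coded function is its table in the order of [enum], and an element is coded by its position in
    that order. *)
Lemma nthT_code_fun (T : finType) A (c : A -> tree) (f : T -> A) x :
  nthT (code_fun c f) (code_elt x) = c (f x).
Proof.
rewrite /nthT /code_fun /code_elt enum_rank_index.
have : x \in enum T by rewrite mem_enum.
have dropE n s : foldT id (fun _ _ => rchild) s (code_nat n) = iter n rchild s.
  by elim: n => //= n <-.
rewrite dropE; elim: (enum T) => //= y s IH; rewrite inE.
case: eqVneq => [->|ne] //= xs.
by rewrite -iterS iterSr IH.
Qed.

Section SumRanks.
Variables A B : finType.

(** The left summand comes first: a left injection keeps its rank, and a right one is shifted by the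
    size of the left summand. This is what lets the compiler number variables. *)
Lemma enum_sum :
  enum {: A + B} = [seq inl x | x <- enum A] ++ [seq inr y | y <- enum B].
Proof. by rewrite !enumT [in LHS]unlock. Qed.

Lemma code_elt_inl (a : A) : code_elt (inl a : A + B) = code_elt a.
Proof.
have inlI : injective (@inl A B) by move=> ? ? [].
rewrite /code_elt !enum_rank_index enum_sum index_cat.
by rewrite mem_map // mem_enum index_map.
Qed.

Lemma code_elt_inr (b : B) :
  code_elt (inr b : A + B) = addT (code_nat #|A|) (code_elt b).
Proof.
have inrI : injective (@inr A B) by move=> ? ? [].
rewrite addT_code /code_elt !enum_rank_index enum_sum index_cat.
have /negbTE-> : inr b \notin [seq inl x | x <- enum A] by apply/negP => /mapP[].
by rewrite size_map -cardE index_map.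
Qed.

End SumRanks.

Lemma enum_option (T : finType) :
  enum {: option T} = None :: [seq Some x | x <- enum T].
Proof. by rewrite !enumT [in LHS]unlock. Qed.

Lemma code_elt_None (T : finType) : code_elt (None : option T) = Leaf.
Proof. by rewrite /code_elt enum_rank_index enum_option. Qed.

Lemma code_elt_Some (T : finType) (x : T) :
  code_elt (Some x) = Node Leaf (code_elt x).
Proof.
rewrite /code_elt !enum_rank_index enum_option /=.
by rewrite index_map //; apply: Some_inj.
Qed.

#[local] Arguments SetNext {Sigma G}.
#[local] Arguments BConst {Sigma G}.
#[local] Arguments BVar {Sigma G}.
#[local] Arguments BRefEq {Sigma G}.
#[local] Arguments BDataLt {Sigma G}.
#[local] Arguments TConst {Sigma G}.
#[local] Arguments TagOf {Sigma G}.
#[local] Arguments SetData {Sigma G}.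
#[local] Arguments SetRef {Sigma G}.

(** * The program of a transducer *)

Section ProgramText.
Context {Sigma Q V X : finType}.

(* The list variables: the output, a scratch copy [inl x] and the current value
   [inr x] of each string variable [x]. *)
Definition listvar : finType := option (X + X)%type.
Definition outv : listvar := None.
Definition tmpv (x : X) : listvar := Some (inl x).
Definition strv (x : X) : listvar := Some (inr x).

(* States are encoded one-hot; the data variable [inl v] has a scratch copy
   [inr v]; a list variable has pointers to its first and last nodes. The other
   Boolean variables tell which data and list variables are defined. *)
Definition psig_of : signature := Signature
  (Q + ((V + V) + listvar))%type void (V + V)%type (listvar + listvar)%type.

Definition bstate (q : Q) : bvar psig_of := inl q.
Definition bdat (v : V + V) : bvar psig_of := inr (inl v).
Definition blist (r : listvar) : bvar psig_of := inr (inr r).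
Definition rfirst (r : listvar) : rvar psig_of := inl r.
Definition rlast (r : listvar) : rvar psig_of := inr r.
Definition dat (v : V + V) : dvar psig_of := v.

Local Notation stmt := (stmt Sigma psig_of).
Local Notation bexp := (bexp Sigma psig_of).
Local Notation item := ((Sigma * V) + listvar)%type.

(* This assignment is an execution error in every configuration. *)
Definition fail : stmt := Assign (SetNext RCurr RNil).
Definition skip : stmt := IfThen (BConst false) fail.
Definition block (l : seq stmt) : stmt := foldr (@Seq _ _) skip l.

Definition rexp_of (x : rvar psig_of) := RRef (RVar x).
Definition is_nil (e : rexp psig_of) : bexp := BRefEq e RNil.
Definition setb x (e : bexp) : stmt := Assign (SetBool x e).
Definition setd x (e : dexp psig_of) : stmt := Assign (SetData x e).
Definition setr x (e : rexp psig_of) : stmt := Assign (SetRef x e).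

Definition clear (r : listvar) : stmt := block
  [:: setr (rfirst r) RNil; setr (rlast r) RNil; setb (blist r) (BConst true)].

Definition push (r : listvar) (g : Sigma) (v : V) : stmt := block
  [:: Assign (New (rfirst r) (TConst g) (DVar (dat (inl v)))
                  (rexp_of (rfirst r)));
      IfThen (is_nil (rexp_of (rlast r))) (setr (rlast r) (rexp_of (rfirst r)));
      (* If [v] is undefined, its dummy value has just been pushed; the flag then discards the whole
         list. *)
      setb (blist r) (BAnd (BVar (blist r)) (BVar (bdat (inl v))))].

Definition prepend (r r' : listvar) : stmt := block
  (* An empty [r'] has no last node to redirect. *)
  [:: IfThen (BNot (is_nil (rexp_of (rfirst r')))) (block
       [:: IfThen (is_nil (rexp_of (rlast r)))
                  (setr (rlast r) (rexp_of (rlast r')));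
           Assign (SetNext (RVar (rlast r')) (rexp_of (rfirst r)));
           setr (rfirst r) (rexp_of (rfirst r'));
           setr (rfirst r') RNil;
           setr (rlast r') RNil]);
      setb (blist r) (BAnd (BVar (blist r)) (BVar (blist r')))].

Definition push_item (r : listvar) (i : item) : stmt :=
  match i with inl (g, v) => push r g v | inr r' => prepend r r' end.

(** Lists grow at the front, so the pattern is executed from right to left, with [clear] innermost
    and hence first. *)
Definition build (r : listvar) (s : seq item) : stmt :=
  foldr (fun i st => Seq st (push_item r i)) (clear r) s.

Definition builds (l : seq (listvar * seq item)) : stmt :=
  block [seq build p.1 p.2 | p <- l].

Definition lift_item (i : (Sigma * V) + X) : item :=
  match i with inl gv => inl gv | inr x => inr (strv x) end.

Definition bdefined (i : item) : bvar psig_of :=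
  match i with inl (g, v) => bdat (inl v) | inr r => blist r end.

Definition all_defined (s : seq item) : bexp :=
  foldr (fun i e => BAnd (BVar (bdefined i)) e) (BConst true) s.

Section Rules.
Variable curr : V.

(** This mirrors the strictness of [eval_test]: all variables of a test must be defined, even those
    that do not affect its truth value. The variable [curr] has just been read. *)
Fixpoint test_defined (phi : test V) : bexp :=
  match phi with
  | TTrue | TFalse => BConst true
  | TBelow v | TAbove v => BVar (bdat (inl v))
  | TNot p => test_defined p
  | TAnd p q | TOr p q => BAnd (test_defined p) (test_defined q)
  end.

Fixpoint test_holds (phi : test V) : bexp :=
  match phi with
  | TTrue => BConst true
  | TFalse => BConst false
  | TBelow v => BDataLt (DVar (dat (inl v))) (DVar (dat (inl curr)))
  | TAbove v => BDataLt (DVar (dat (inl curr))) (DVar (dat (inl v)))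
  | TNot p => BNot (test_holds p)
  | TAnd p q => BAnd (test_holds p) (test_holds q)
  | TOr p q => BOr (test_holds p) (test_holds q)
  end.

Definition guard (t : transition Sigma Sigma Q V X) : bexp :=
  BAnd (BVar (bstate (tsrc t)))
    (BAnd (BTagEq (TagOf RCurr) (TConst (ttag t)))
      (BAnd (test_defined (ttest t)) (test_holds (ttest t)))).

Definition update (t : transition Sigma Sigma Q V X) : stmt := block
  (* Strings come before data, as their patterns refer to the data values from before the update. *)
  [:: builds [seq (tmpv x, map lift_item (tstr t x)) | x <- enum X];
      builds [seq (strv x, [:: inr (tmpv x)]) | x <- enum X];
      block [seq Seq (setd (dat (inr v)) (DVar (dat (inl (tdata t v)))))
                     (setb (bdat (inr v)) (BVar (bdat (inl (tdata t v)))))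
            | v <- enum V];
      block [seq Seq (setd (dat (inl v)) (DVar (dat (inr v))))
                     (setb (bdat (inl v)) (BVar (bdat (inr v))))
            | v <- enum V];
      (* The source is reset before the target is set, so that a transition from a state to itself
         keeps the flag. *)
      setb (bstate (tsrc t)) (BConst false);
      setb (bstate (tdst t)) (BConst true)].

Definition rules (ts : seq (transition Sigma Sigma Q V X)) : stmt :=
  foldr (fun t => IfThenElse (guard t) (update t)) fail ts.

Definition read_curr : stmt :=
  Seq (setd (dat (inl curr)) (DataOf RCurr))
      (setb (bdat (inl curr)) (BConst true)).

Definition at_end : bexp := is_nil (RRef RCurr).

Definition loop ts : stmt :=
  While (BNot at_end) (block [:: read_curr; rules ts; Assign Advance]).

End Rules.

(** Definedness is tested before building, since no dummy values exist on the empty input. A failed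
    test falls through to [fail], as no other state flag holds. *)
Definition finish_at (out : {ffun Q -> option (pattern Sigma V X)}) q k : stmt :=
  if out q is Some s then
    IfThenElse (BAnd (BVar (bstate q)) (all_defined (map lift_item s)))
               (build outv (map lift_item s)) k
  else k.

Definition finish (out : {ffun Q -> option (pattern Sigma V X)}) : stmt :=
  foldr (finish_at out) fail (enum Q).

(* Undefined data variables are given a dummy value: [BAnd] is strict, so the
   tests of a guard are evaluated even if one of their variables is undefined. *)
Definition setup (q0 : Q) : stmt := block
  [:: setb (bstate q0) (BConst true);
      block [seq setb (blist (strv x)) (BConst true) | x <- enum X];
      IfThen (BNot at_end)
        (block [seq setd (dat (inl v)) (DataOf RCurr) | v <- enum V])].

End ProgramText.
Arguments psig_of : clear implicits.
Arguments listvar : clear implicits.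

Section Compiled.
Context {disp : Order.disp_t} {D : orderType disp} {Sigma : finType}.
Variable S : sdst D Sigma Sigma.

Let sig := psig_of (state S) (datavar S) (strvar S).

Definition body_of : stmt Sigma sig := block
  [:: setup (start S); loop (curr S) (trans S); finish (output S)].

(** There are no tag variables, so [Input] annotates an empty type: the program takes and returns
    nothing but lists. *)
Definition program_of : program Sigma.
Proof.
refine (@Program Sigma sig [ffun=> Local (inl false)] [ffun=> Input]
  [ffun=> Local None] [ffun=> InitNil] (rfirst outv) body_of _ _ _).
- by move=> x y; rewrite ffunE.
- by case.
- by move=> x y; rewrite ffunE.
Defined.

End Compiled.

(** * Execution *)

Section Execution.
Context {disp : Order.disp_t} {D : orderType disp} {Sigma : finType}.
Context {G : signature}.
Implicit Types (h : heap Sigma D) (s : store Sigma D G) (c : config Sigma D G).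

Lemma reaches_refl c : reaches c c.
Proof. by exists 0. Qed.

Lemma reaches_step c c1 c2 : step c = Some c1 -> reaches c1 c2 -> reaches c c2.
Proof. by move=> cc1 [n c12]; exists n.+1; rewrite iterSr /= cc1. Qed.

Lemma reaches_trans c c1 c2 : reaches c c1 -> reaches c1 c2 -> reaches c c2.
Proof.
by move=> [n cc1] [m c12]; exists (m + n); rewrite iterD cc1.
Qed.

(** By determinism, any halting configuration is the one reached by an execution constructed
    elsewhere. *)
Lemma reaches_halt_inj c c1 c2 : step c1 = None -> step c2 = None ->
  reaches c c1 -> reaches c c2 -> c1 = c2.
Proof.
move=> h1 h2 [n c1n] [m c2m].
have halted c' : step c' = None -> forall j, 0 < j ->
    iter j (obind (@step _ _ _ G)) (Some c') = None.
  move=> hc' [//|j] _; rewrite iterSr /= hc'.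
  by elim: j => //= j ->.
case: (ltngtP n m) => [lt|lt|eq].
- have := halted _ h1 (m - n); rewrite subn_gt0 => /(_ lt).
  by rewrite -c1n -iterD subnK ?c2m // ltnW.
- have := halted _ h2 (n - m); rewrite subn_gt0 => /(_ lt).
  by rewrite -c2m -iterD subnK ?c1n // ltnW.
- by move: c1n; rewrite eq c2m => -[].
Qed.

Definition runs (st : stmt Sigma G) h s h' s' : Prop :=
  forall k, reaches (Config (st :: k) h s) (Config k h' s').

(** Being stuck is not enough: at the exit location it would count as producing an output. *)
Definition crashes (st : stmt Sigma G) h s : Prop :=
  forall k, exists c,
    [/\ reaches (Config (st :: k) h s) c, step c = None & location c <> [::]].

Lemma runs_assign a h s h' s' :
  exec h s a = Some (h', s') -> runs (Assign a) h s h' s'.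
Proof.
by move=> E k; apply: reaches_step _ (reaches_refl _); rewrite /= E.
Qed.

Lemma runs_seq st1 st2 h s h1 s1 h2 s2 :
  runs st1 h s h1 s1 -> runs st2 h1 s1 h2 s2 -> runs (Seq st1 st2) h s h2 s2.
Proof.
move=> r1 r2 k; apply: (@reaches_step _ (Config [:: st1, st2 & k] h s)) => //.
exact: reaches_trans (r1 _) (r2 _).
Qed.


Lemma runs_if_true e st h s h' s' : eval_bexp h s e = Some true ->
  runs st h s h' s' -> runs (IfThen e st) h s h' s'.
Proof.
by move=> E r k; apply: reaches_step _ (r k); rewrite /= E.
Qed.

Lemma runs_if_false e st h s : eval_bexp h s e = Some false ->
  runs (IfThen e st) h s h s.
Proof.
by move=> E k; apply: reaches_step _ (reaches_refl _); rewrite /= E.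
Qed.

Lemma runs_ifelse e (b : bool) st1 st2 h s h' s' : eval_bexp h s e = Some b ->
  runs (if b then st1 else st2) h s h' s' ->
  runs (IfThenElse e st1 st2) h s h' s'.
Proof.
by move=> E r k; apply: reaches_step _ (r k); rewrite /= E.
Qed.

Lemma crashes_ifelse e (b : bool) st1 st2 h s : eval_bexp h s e = Some b ->
  crashes (if b then st1 else st2) h s -> crashes (IfThenElse e st1 st2) h s.
Proof.
move=> E r k; have [c [rc hc lc]] := r k; exists c; split=> //.
by apply: reaches_step _ rc; rewrite /= E.
Qed.

Lemma crashes_seq st1 st2 h s : crashes st1 h s -> crashes (Seq st1 st2) h s.
Proof.
move=> r k; have [c [rc hc lc]] := r (st2 :: k); exists c; split=> //.
exact: (@reaches_step _ (Config [:: st1, st2 & k] h s)).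
Qed.

Lemma runs_crashes st1 st2 h s h1 s1 :
  runs st1 h s h1 s1 -> crashes st2 h1 s1 -> crashes (Seq st1 st2) h s.
Proof.
move=> r1 r k; have [c [rc hc lc]] := r k; exists c; split=> //.
by apply: (@reaches_step _ (Config [:: st1, st2 & k] h s)) => //;
  apply: reaches_trans (r1 _) rc.
Qed.

End Execution.

(** * Linked lists *)

Section LinkedLists.
Context {disp : Order.disp_t} {D : orderType disp} {Sigma : finType}.
Implicit Types (h : heap Sigma D) (ns : seq nat) (w : dstring Sigma D).

(** Unlike [list_at], this keeps the addresses [ns], in terms of which disjointness and last nodes
    are stated. *)
Fixpoint lseg h (p : pointer) ns w : Prop :=
  match ns, w with
  | [::], [::] => p = None
  | n :: ns', (t, d) :: w' =>
      p = Some n /\ exists2 q, onth h n = Some (Cell t d q) & lseg h q ns' w'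
  | _, _ => False
  end.

Definition olast ns : pointer := if ns is n :: ns' then Some (last n ns') else None.

Lemma lseg_ohead h p ns w : lseg h p ns w -> p = ohead ns.
Proof. by case: ns w => [|n ns] [|[t d] w] //= []. Qed.

Lemma lseg_nil h p w : lseg h p [::] w -> w = [::].
Proof. by case: w. Qed.

Lemma lseg_frame h h' p ns w : {in ns, onth h' =1 onth h} ->
  lseg h p ns w -> lseg h' p ns w.
Proof.
elim: ns p w => [|n ns IH] p [|[t d] w] //= hh' [-> [q hn l]].
split=> //; exists q; first by rewrite hh' ?mem_head.
by apply: IH l => n' n'ns; rewrite hh' // inE n'ns orbT.
Qed.

Lemma lseg_lt h p ns w n : lseg h p ns w -> n \in ns -> n < size h.
Proof.
elim: ns p w => [|n' ns IH] p [|[t d] w] //= [_ [q hn /IH l]].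
by rewrite inE => /orP[/eqP->|/l //]; rewrite -onthTE hn.
Qed.

Lemma lseg_list_at h p ns w : lseg h p ns w -> list_at h p w.
Proof.
elim: ns p w => [|n ns IH] p [|[t d] w] //= => [->|[-> [q hn /IH l]]].
  exact: ListNil.
exact: (ListCons hn).
Qed.

Lemma list_at_inj h p w1 w2 : list_at h p w1 -> list_at h p w2 -> w1 = w2.
Proof.
move=> l; elim: l w2 => [|n c w hn _ IH] w2 l2.
  by inversion l2.
inversion l2 as [|n' c' w' hn' lw']; subst.
by move: hn'; rewrite hn => -[ec]; move: lw'; rewrite -ec => /IH->.
Qed.

Definition set_next h n (p : pointer) : heap Sigma D :=
  if onth h n is Some c then set_nth c h n (Cell (ctag c) (cdata c) p) else h.

Lemma onth_set_next h n p i : n < size h ->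
  onth (set_next h n p) i =
  if i == n then omap (fun c => Cell (ctag c) (cdata c) p) (onth h n)
  else onth h i.
Proof.
move=> ltn; rewrite /set_next; have := ltn; rewrite -onthTE.
case E: (onth h n) => [c|//] _.
have sz : size (set_nth c h n (Cell (ctag c) (cdata c) p)) = size h.
  by rewrite size_set_nth; apply/maxn_idPr.
case: (ltnP i (size h)) => lti; last first.
  by rewrite (gtn_eqF (leq_trans ltn lti)) !onth_default ?sz.
have onth_some (l : heap Sigma D) j : j < size l -> onth l j = Some (nth c l j).
  by move=> ltj; rewrite onthE (nth_map c).
rewrite onth_some ?sz // nth_set_nth /=.
by case: eqP => // _; rewrite onth_some.
Qed.

(** As the addresses are distinct, redirecting [z] alters neither the cells before it nor the second
    segment. *)
Lemma lseg_cat h p1 n ns1 w1 p2 ns2 w2 (z := last n ns1) :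
  uniq (n :: ns1) -> z \notin ns2 ->
  lseg h p1 (n :: ns1) w1 -> lseg h p2 ns2 w2 ->
  lseg (set_next h z p2) p1 (n :: ns1 ++ ns2) (w1 ++ w2).
Proof.
elim: ns1 n p1 w1 @z => [|n1 ns1 IH] n p1 [|[t d] w1] z us zns2 //= [-> [q hn l1]] l2.
  have ltn : n < size h by rewrite -onthTE hn.
  split=> //; exists p2; first by rewrite onth_set_next // eqxx hn.
  case: w1 l1 => // _ /=; apply: lseg_frame l2 => i i2.
  by rewrite onth_set_next //; case: eqP => // e; rewrite -e i2 in zns2.
have z1 : z \in n1 :: ns1 by apply: mem_last.
have /andP[nns1 us1] := us.
have ltz := @lseg_lt h q (n1 :: ns1) w1 z l1 z1.
split=> //; exists q; last exact: (IH n1 q w1).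
by rewrite onth_set_next // ifN //; apply: contraTneq z1 => <-.
Qed.

Lemma onth_rcons h c n : n < size h -> onth (rcons h c) n = onth h n.
Proof. by move=> ltn; rewrite -cats1 onth_cat ltn. Qed.

Lemma onth_rcons_size h c : onth (rcons h c) (size h) = Some c.
Proof. by rewrite -cats1 onth_cat ltnn subnn. Qed.

(** Input nodes are consecutive, so one position describes the whole unread suffix. *)
Fixpoint input_at h (i : nat) w : Prop :=
  if w is (t, d) :: w' then
    onth h i = Some (Cell t d (if w' is [::] then None else Some i.+1)) /\
    input_at h i.+1 w'
  else True.

Lemma input_at_frame h h' i w :
  (forall j, j < i + size w -> onth h' j = onth h j) ->
  input_at h i w -> input_at h' i w.
Proof.
elim: w i => //= -[t d] w IH i hh' [hi l]; split.
  by rewrite hh' // addnS ltnS leq_addr.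
by apply: IH l => j; rewrite addSnnS; apply: hh'.
Qed.

End LinkedLists.

(** * Abstract stores *)

Section Abstract.
Context {disp : Order.disp_t} {D : orderType disp} {Sigma Q V X : finType}.

Local Notation G := (psig_of Q V X).
Local Notation R := (listvar X).
Local Notation item := ((Sigma * V) + R)%type.
Implicit Types (h : heap Sigma D) (s : store Sigma D G) (w : dstring Sigma D).
Implicit Types (r : R).

(** What is left of a store when addresses are forgotten: a list variable holds a string. *)
Record abs := Abs {
  ab : bvar G -> bool;
  ad : V + V -> option D;
  aw : R -> dstring Sigma D }.
Implicit Types a : abs.

(** A separation invariant: the lists avoid the [m] input nodes and each other, so a destructive
    update of one leaves all else intact. *)
Definition linked (m : nat) h s (ns : R -> seq nat) (ws : R -> dstring Sigma D) :=
  [/\ forall r, lseg h (rval s (rfirst r)) (ns r) (ws r),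
      forall r, rval s (rlast r) = olast (ns r),
      forall r, uniq (ns r),
      forall r n, n \in ns r -> m <= n &
      forall r1 r2 n, n \in ns r1 -> n \in ns r2 -> r1 = r2].

(* The first [m] nodes are those of the input, of which [w] remains to be read. *)
Definition rep (m : nat) w h s a : Prop :=
  [/\ exists i, [/\ i + size w = m, m <= size h, input_at h i w &
                    cval s = if w is [::] then None else Some i],
      bval s =1 ab a, dval s =1 ad a &
      exists ns, linked m h s ns (aw a)].

(** A total-correctness triple with the unread input [w] fixed; only [Advance] consumes input, and
    it is treated separately. *)
Definition tr w (st : stmt Sigma G) a a' : Prop :=
  forall m h s, rep m w h s a ->
    exists h' s', runs st h s h' s' /\ rep m w h' s' a'.

Definition trcrash w (st : stmt Sigma G) a : Prop :=
  forall m h s, rep m w h s a -> crashes st h s.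

Definition evals w (e : bexp Sigma G) a (b : bool) : Prop :=
  forall m h s, rep m w h s a -> eval_bexp h s e = Some b.

Definition absb x b a := Abs [eta ab a with x |-> b] (ad a) (aw a).
Definition absd v d a := Abs (ab a) [eta ad a with v |-> d] (aw a).
Definition absw r u a := Abs (ab a) (ad a) [eta aw a with r |-> u].

Lemma tr_seq w st1 st2 a a1 a2 :
  tr w st1 a a1 -> tr w st2 a1 a2 -> tr w (Seq st1 st2) a a2.
Proof.
move=> t1 t2 m h s /t1[h1 [s1 [r1 /t2[h2 [s2 [r2 rep2]]]]]].
by exists h2, s2; split=> //; apply: runs_seq r1 r2.
Qed.

Lemma tr_skip w a : tr w skip a a.
Proof. by move=> m h s ra; exists h, s; split=> //; apply: runs_if_false. Qed.

Lemma tr_if w e (b : bool) st a a' :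
  evals w e a b -> (if b then tr w st a a' else a = a') ->
  tr w (IfThen e st) a a'.
Proof.
move=> eb; case: b eb => eb.
  move=> t m h s ra; have [h' [s' [r ra']]] := t _ _ _ ra.
  by exists h', s'; split=> //; apply: runs_if_true r; apply: eb ra.
by move=> <- m h s ra; exists h, s; split=> //; apply: runs_if_false (eb _ _ _ ra).
Qed.

Lemma tr_ifelse w e (b : bool) st1 st2 a a' :
  evals w e a b -> tr w (if b then st1 else st2) a a' ->
  tr w (IfThenElse e st1 st2) a a'.
Proof.
move=> eb t m h s ra; have [h' [s' [r ra']]] := t _ _ _ ra.
by exists h', s'; split=> //; apply: runs_ifelse r; apply: eb ra.
Qed.

Lemma trcrash_ifelse w e (b : bool) st1 st2 a :
  evals w e a b -> trcrash w (if b then st1 else st2) a ->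
  trcrash w (IfThenElse e st1 st2) a.
Proof.
by move=> eb t m h s ra; apply: crashes_ifelse (eb _ _ _ ra) (t _ _ _ ra).
Qed.

Lemma trcrash_fail w a : trcrash w fail a.
Proof.
move=> m h s _ k; exists (Config (fail :: k) h s); split=> //.
  exact: reaches_refl.
by rewrite /=; case: (cval s) => //= n; rewrite eqxx.
Qed.

Lemma tr_block_map T (f : T -> stmt Sigma G) (F : T -> abs -> abs) w l a :
  (forall x a, tr w (f x) a (F x a)) ->
  tr w (block [seq f x | x <- l]) a (foldl (fun a x => F x a) a l).
Proof.
move=> tf; elim: l a => [|x l IH] a; first exact: tr_skip.
exact: tr_seq (tf x a) (IH _).
Qed.

Lemma tr_setb w x e b a : evals w e a b -> tr w (setb x e) a (absb x b a).
Proof.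
move=> eb m h s ra; exists h, (set_bval s x b); split.
  by apply: runs_assign; rewrite /= (eb _ _ _ ra).
case: ra => ri rb rd rl; split=> // y /=.
by case: eqP => // _; apply: rb.
Qed.

Lemma tr_setd w x y a :
  tr w (setd (dat x) (DVar (dat y))) a (absd x (ad a y) a).
Proof.
move=> m h s ra; exists h, (set_dval s (dat x) (dval s (dat y))); split.
  exact: runs_assign.
case: ra => ri rb rd rl; split=> // z /=.
by case: eqP => // _; apply: rd.
Qed.

Lemma rep_curr m p w h s a :
  rep m (p :: w) h s a ->
  deref h (cval s) = Some (Cell p.1 p.2 (if w is [::] then None else
    if cval s is Some i then Some i.+1 else None)).
Proof. by case: p => t d [[i [_ _ /= [hi _] ->]] _ _ _]. Qed.

Lemma tr_setd_curr p w x a :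
  tr (p :: w) (setd (dat x) (DataOf RCurr)) a (absd x (Some p.2) a).
Proof.
move=> m h s ra; exists h, (set_dval s (dat x) (Some p.2)); split.
  by apply: runs_assign; rewrite /= (rep_curr ra).
case: ra => ri rb rd rl; split=> // z /=.
by case: eqP => // _; apply: rd.
Qed.

Lemma evals_const w b a : evals w (BConst b) a b.
Proof. by []. Qed.

Lemma evals_var w x a : evals w (BVar x) a (ab a x).
Proof. by move=> m h s [_ rb _ _] /=; rewrite rb. Qed.

Lemma evals_not w e a b : evals w e a b -> evals w (BNot e) a (~~ b).
Proof. by move=> eb m h s ra /=; rewrite (eb _ _ _ ra). Qed.

Lemma evals_and w e1 e2 a b1 b2 : evals w e1 a b1 -> evals w e2 a b2 ->
  evals w (BAnd e1 e2) a (b1 && b2).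
Proof. by move=> e1b e2b m h s ra /=; rewrite (e1b _ _ _ ra) (e2b _ _ _ ra). Qed.

Lemma evals_or w e1 e2 a b1 b2 : evals w e1 a b1 -> evals w e2 a b2 ->
  evals w (BOr e1 e2) a (b1 || b2).
Proof. by move=> e1b e2b m h s ra /=; rewrite (e1b _ _ _ ra) (e2b _ _ _ ra). Qed.

Lemma evals_at_end w a : evals w at_end a (nilp w).
Proof. by case: w => [|p w] m h s [[i [_ _ _ /= ->]] _ _ _]. Qed.

(** * Building lists *)

Definition ival a (i : item) : dstring Sigma D :=
  match i with
  | inl (g, v) => if ad a (inl v) is Some d then [:: (g, d)] else [::]
  | inr r => aw a r
  end.

Definition idef a (i : item) : bool := ab a (bdefined i).

Definition aclear r a := absb (blist r) true (absw r [::] a).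

Definition apush r (i : item) a :=
  absb (blist r) (ab a (blist r) && idef a i)
    (absw r (ival a i ++ aw a r)
      (if i is inr r' then absw r' [::] a else a)).

Definition abuild r (l : seq item) a := foldr (apush r) (aclear r a) l.

Definition sources (l : seq item) : seq R :=
  pmap (fun i => if i is inr r then Some r else None) l.

(** This and the next lemmas hold by conversion; they turn comparisons of pointer variables into
    comparisons of list variables. *)
Lemma rval_first_first s r p r' :
  rval (set_rval s (rfirst r) p) (rfirst r') =
  if r' == r then p else rval s (rfirst r').
Proof. by []. Qed.

Lemma rval_last_last s r p r' :
  rval (set_rval s (rlast r) p) (rlast r') =
  if r' == r then p else rval s (rlast r').
Proof. by []. Qed.

Lemma rval_first_last s r p r' :
  rval (set_rval s (rfirst r) p) (rlast r') = rval s (rlast r').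
Proof. by []. Qed.

Lemma rval_last_first s r p r' :
  rval (set_rval s (rlast r) p) (rfirst r') = rval s (rfirst r').
Proof. by []. Qed.

Lemma rval_bool s x b y : rval (set_bval s x b) y = rval s y.
Proof. by []. Qed.

Let rvalE := (rval_bool, rval_first_first, rval_last_last, rval_first_last,
  rval_last_first).

Lemma tr_clear w r a : tr w (clear r) a (aclear r a).
Proof.
move=> m h s [ri rb rd [ns [l1 l2 l3 l4 l5]]].
pose s1 := set_rval (set_rval s (rfirst r) None) (rlast r) None.
exists h, (set_bval s1 (blist r) true); split.
  apply: runs_seq; first exact: runs_assign.
  apply: runs_seq; first exact: runs_assign.
  by apply: runs_seq; [exact: runs_assign | exact: runs_if_false].
split=> //=; first by move=> x; rewrite /=; case: eqP => // _; apply: rb.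
exists [eta ns with r |-> [::]].
split=> [r0|r0|r0|r0 n|r1 r2 n]; rewrite ?rvalE /=.
- by case: eqP.
- by case: eqP.
- by case: eqP.
- by case: eqP => // _; apply: l4.
- by do 2!case: eqP => //= _; apply: l5.
Qed.

Lemma tr_push w r g v a : ad a (inl v) -> tr w (push r g v) a (apush r (inl (g, v)) a).
Proof.
case Ev: (ad a (inl v)) => [d|//] _ m h s [[i [im mh hi si]] rb rd [ns [l1 l2 l3 l4 l5]]].
pose n := size h.
pose h1 := rcons h (Cell g d (rval s (rfirst r))).
pose s1 := set_rval s (rfirst r) (Some n).
pose s2 := if rval s (rlast r) is None then set_rval s1 (rlast r) (Some n) else s1.
pose b := ab a (blist r) && ab a (bdat (inl v)).
have frame r0 : lseg h1 (rval s (rfirst r0)) (ns r0) (aw a r0).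
  apply: lseg_frame (l1 r0) => j jr; apply: onth_rcons.
  exact: lseg_lt (l1 r0) jr.
have fresh r0 : n \notin ns r0.
  by apply/negP => /(lseg_lt (l1 r0)); rewrite ltnn.
have b2 x : bval s2 x = ab a x by rewrite -rb /s2; case: (rval s (rlast r)).
have d2 x : dval s2 x = ad a x by rewrite -rd /s2; case: (rval s (rlast r)).
have c2 : cval s2 = cval s by rewrite /s2; case: (rval s (rlast r)).
exists h1, (set_bval s2 (blist r) b); split.
  apply: (@runs_seq _ _ _ _ _ _ _ _ h1 s1).
    by apply: runs_assign; rewrite /= rd Ev.
  apply: (@runs_seq _ _ _ _ _ _ _ _ h1 s2).
    rewrite /s2; case E: (rval s (rlast r)) => [z|]; last first.
      apply: runs_if_true; first by rewrite /= [rval _ _]E.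
      by apply: runs_assign; rewrite /= /s1 eqxx.
    by apply: runs_if_false; rewrite /= [rval _ _]E.
  apply: runs_seq; last exact: runs_if_false.
  by apply: runs_assign; rewrite /= b2 b2.
split=> //=.
- exists i; split=> //; [by rewrite size_rcons ltnW | | by rewrite c2].
  apply: input_at_frame hi => j; rewrite im => jm.
  by apply: onth_rcons; apply: leq_trans jm mh.
- by move=> x /=; rewrite b2.
exists [eta ns with r |-> n :: ns r].
have f2 r0 : rval s2 (rfirst r0) = if r0 == r then Some n else rval s (rfirst r0).
  by rewrite /s2; case: (rval s (rlast r)).
have t2 r0 : rval s2 (rlast r0) =
    if (r0 == r) && ~~ rval s (rlast r) then Some n else rval s (rlast r0).
  rewrite /s2; case: (rval s (rlast r)) => [z|]; last by rewrite rvalE andbT.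
  by rewrite andbF.
split=> [r0|r0|r0|r0 j|r1 r2 j]; rewrite ?rvalE ?f2 ?t2 /=.
- case: eqP => [_|_] //=; rewrite Ev /=; split=> //.
  exists (rval s (rfirst r)) => //; exact: onth_rcons_size.
- case: (eqVneq r0 r) => [->|_] /=; last exact: l2.
  by rewrite l2; case: (ns r).
- by case: eqP => //= _; rewrite fresh l3.
- case: eqP => [_|_]; last exact: l4.
  by rewrite inE => /orP[/eqP->//|]; apply: l4.
- case: eqP => [->|_]; case: eqP => [->|_] //; rewrite ?inE.
  + by case: eqP => [-> _|_ /= jr]; [rewrite (negbTE (fresh _)) | apply: l5].
  + by move=> j1; case: eqP => [ej|_ /=];
      [move: j1; rewrite ej (negbTE (fresh _)) | apply: l5].
  + exact: l5.
Qed.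

Lemma tr_prepend w r r' a : r != r' -> tr w (prepend r r') a (apush r (inr r') a).
Proof.
move=> rr' m h s [[i [im mh hi si]] rb rd [ns [l1 l2 l3 l4 l5]]].
pose b := ab a (blist r) && ab a (blist r').
case Er': (ns r') => [|n l].
  have fr' : rval s (rfirst r') = None by rewrite (lseg_ohead (l1 r')) Er'.
  have ar' : aw a r' = [::] by have := l1 r'; rewrite Er' => /lseg_nil.
  exists h, (set_bval s (blist r) b); split.
    apply: runs_seq; first by apply: runs_if_false; rewrite /= [rval _ _]fr'.
    apply: runs_seq; last exact: runs_if_false.
    by apply: runs_assign; rewrite /= !rb.
  split=> //=; first by exists i.
    by move=> x /=; rewrite rb.
  exists ns; split=> // r0; rewrite rvalE /=.
  case: (eqVneq r0 r) => [->|_]; first by rewrite ar'.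
  by case: (eqVneq r0 r') => [->|_]; rewrite -?ar'.
pose z := last n l.
have fr' : rval s (rfirst r') = Some n by rewrite (lseg_ohead (l1 r')) Er'.
have lr' : rval s (rlast r') = Some z by rewrite l2 Er'.
have zr' : z \in ns r' by rewrite Er' mem_last.
have znot r0 : r0 != r' -> z \notin ns r0.
  by move=> ne; apply: contraNN ne => /l5/(_ zr')/eqP.
have ltz := lseg_lt (l1 r') zr'.
pose h1 := set_next h z (rval s (rfirst r)).
pose s1 := if rval s (rlast r) is None then set_rval s (rlast r) (Some z) else s.
pose s2 := set_rval s1 (rfirst r) (Some n).
pose s3 := set_rval s2 (rfirst r') None.
pose s4 := set_rval s3 (rlast r') None.
have b1 x : bval s1 x = ab a x by rewrite -rb /s1; case: (rval s (rlast r)).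
have d1 x : dval s1 x = ad a x by rewrite -rd /s1; case: (rval s (rlast r)).
have c1 : cval s1 = cval s by rewrite /s1; case: (rval s (rlast r)).
have f1 r0 : rval s1 (rfirst r0) = rval s (rfirst r0).
  by rewrite /s1; case: (rval s (rlast r)).
have t1 r0 : rval s1 (rlast r0) =
    if (r0 == r) && ~~ rval s (rlast r) then Some z else rval s (rlast r0).
  rewrite /s1; case: (rval s (rlast r)) => [?|]; last by rewrite rvalE andbT.
  by rewrite andbF.
have r'r : (r' == r) = false by rewrite eq_sym (negbTE rr').
have frame j : j != z -> onth h1 j = onth h j.
  by move=> jz; rewrite onth_set_next // (negbTE jz).
have [c hz] : exists c, onth h z = Some c.
  by move: ltz; rewrite -onthTE; case: (onth h z) => // c; exists c.
exists h1, (set_bval s4 (blist r) b); split.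
  apply: (@runs_seq _ _ _ _ _ _ _ _ h1 s4).
    apply: runs_if_true; first by rewrite /= [rval _ _]fr'.
    apply: (@runs_seq _ _ _ _ _ _ _ _ h s1).
      rewrite /s1; case E: (rval s (rlast r)) => [y|].
        by apply: runs_if_false; rewrite /= [rval _ _]E.
      apply: runs_if_true; first by rewrite /= [rval _ _]E.
      by apply: runs_assign; rewrite /= [rval _ _]lr'.
    apply: (@runs_seq _ _ _ _ _ _ _ _ h1 s1).
      apply: runs_assign; rewrite /= [rval _ _]t1 r'r /= lr' ifF.
        by rewrite hz /= [rval _ _]f1 /h1 /set_next hz.
      (* The redirected node is not that of [curr]: it lies at position [m] or beyond, while an
         unread input node lies before [m]. *)
      rewrite c1 si; case: w im {hi si} => // p w im; apply/eqP => -[iz].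
      by have := l4 _ _ zr'; rewrite -im -iz /= addnS ltnNge leq_addr.
    apply: (@runs_seq _ _ _ _ _ _ _ _ h1 s2).
      by apply: runs_assign; rewrite /= [rval _ _]f1 fr'.
    apply: (@runs_seq _ _ _ _ _ _ _ _ h1 s3); first exact: runs_assign.
    apply: (@runs_seq _ _ _ _ _ _ _ _ h1 s4); first exact: runs_assign.
    exact: runs_if_false.
  apply: runs_seq; last exact: runs_if_false.
  by apply: runs_assign; rewrite /= !b1.
split=> //=.
- exists i; split=> //; last by rewrite c1.
    by rewrite /h1 /set_next hz size_set_nth (maxn_idPr _).
  apply: input_at_frame hi => j; rewrite im => jm.
  apply: frame; rewrite neq_ltn (leq_trans jm) //; exact: l4 zr'.
- by move=> x /=; rewrite b1.
exists [eta [eta ns with r' |-> [::]] with r |-> ns r' ++ ns r].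
split=> [r0|r0|r0|r0 j|r1 r2 j]; rewrite ?rvalE /= ?f1 ?t1 ?rvalE ?f1.
- case: (eqVneq r0 r) => [->|ne]; first rewrite (negbTE rr').
    rewrite Er'; have := l1 r'; rewrite Er' fr' => lr1.
    by apply: lseg_cat lr1 (l1 r); [rewrite -Er' | apply: znot].
  case: (eqVneq r0 r') => // ne'.
  apply: lseg_frame (l1 r0) => j jr; apply: frame.
  by apply: contraTneq jr => ->; apply: znot.
- case: (eqVneq r0 r) => [->|ne]; first rewrite (negbTE rr') /=.
    by rewrite Er' l2; case: (ns r) => [|k q] /=; rewrite ?cats0 // last_cat.
  by case: eqP => //= _; rewrite l2.
- case: (eqVneq r0 r) => [_|ne]; last by case: eqP.
  rewrite cat_uniq !l3 andbT /=; apply/hasPn => j jr /=.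
  by apply: contraNN rr' => jr'; apply/eqP; apply: l5 jr jr'.
- case: eqP => [_|_]; first by rewrite mem_cat => /orP[]; apply: l4.
  by case: eqP => // _; apply: l4.
- case: (eqVneq r1 r) => [->|n1]; case: (eqVneq r2 r) => [->|n2] //.
  + rewrite mem_cat; case: (eqVneq r2 r') => // ne /orP[/l5 e|/l5 e] /e //.
    by move=> e2; rewrite e2 eqxx in ne.
  + rewrite mem_cat; case: (eqVneq r1 r') => // ne /l5 e /orP[/e|/e] //.
    by move=> e2; rewrite e2 eqxx in ne.
  + by do 2!case: eqP => // _; apply: l5.
Qed.

(** The target may not be a source: prepending a list to itself would tie a cycle. *)
Lemma tr_build w r l a : r \notin sources l ->
  (forall g v, inl (g, v) \in l -> ad a (inl v)) ->
  tr w (build r l) a (abuild r l a).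
Proof.
elim: l => [|i l IH] rl dl; first exact: tr_clear.
have adE : ad (abuild r l a) =1 ad a.
  by elim: l {IH rl dl} => //= -[[g v]|r'] l.
apply: tr_seq.
  apply: IH => [|g v gvl]; last by apply: (dl g v); rewrite inE gvl orbT.
  by move: rl; case: i {dl} => [?|?] //=; rewrite inE negb_or => /andP[].
case: i rl dl => [[g v]|r'] rl dl.
  by apply: tr_push; rewrite adE; apply: (dl g v); rewrite mem_head.
by apply: tr_prepend; move: rl; rewrite /= inE negb_or => /andP[].
Qed.

End Abstract.

(** * Sequences of builds and copies as simultaneous assignments *)

Section Effects.
Context {disp : Order.disp_t} {D : orderType disp} {Sigma Q V X : finType}.

Local Notation G := (psig_of Q V X).
Local Notation R := (listvar X).
Local Notation item := ((Sigma * V) + R)%type.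
Local Notation abs := (@abs disp D Sigma Q V X).
Implicit Types (a : abs) (r : R) (l : seq item) (w : dstring Sigma D).

Lemma ad_abuild r l a : ad (abuild r l a) = ad a.
Proof. by elim: l => //= -[[g v]|r'] l. Qed.

Lemma ab_abuild_other r l a x : x != blist r -> ab (abuild r l a) x = ab a x.
Proof.
move=> /negbTE ne; elim: l => [|i l IH] /=; rewrite ne //.
by case: i => [[g v]|r'].
Qed.

Lemma aw_abuild_other r l a r0 : r0 != r -> r0 \notin sources l ->
  aw (abuild r l a) r0 = aw a r0.
Proof.
move=> /negbTE ne; elim: l => [|[[g v]|r'] l IH] /=; rewrite ne //.
by rewrite inE negb_or => /andP[/negbTE-> /IH].
Qed.

(** A second occurrence of a source would find the list emptied by the first; [uniq (sources l)] is
    where copylessness enters. *)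
Lemma abuildP r l a : r \notin sources l -> uniq (sources l) ->
  aw (abuild r l a) r = flatten [seq ival a i | i <- l] /\
  ab (abuild r l a) (blist r) = all (idef a) l.
Proof.
elim: l => [|i l IH] /= rl ul; first by rewrite !eqxx.
have rl' : r \notin sources l.
  by move: rl; case: (i) => [?|?] //=; rewrite inE negb_or => /andP[].
have ul' : uniq (sources l) by move: ul; case: (i) => //= r' /andP[].
have [-> ->] := IH rl' ul'; rewrite !eqxx; split.
  congr cat; case: i rl ul {IH} => [[g v]|r'] /=; first by rewrite ad_abuild.
  rewrite inE negb_or => /andP[ne _] /andP[nl _].
  by rewrite aw_abuild_other // eq_sym.
rewrite [RHS]andbC; congr andb; rewrite /idef; apply: ab_abuild_other.
case: i rl {ul IH} => [[g v] //|r'] /=; rewrite inE negb_or => /andP[ne _].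
by apply: contraNneq ne => -[->].
Qed.

Definition abuilds (ps : seq (R * seq item)) a :=
  foldl (fun a p => abuild p.1 p.2 a) a ps.

Definition psources (ps : seq (R * seq item)) : seq R :=
  flatten [seq sources p.2 | p <- ps].

Lemma ad_abuilds ps a : ad (abuilds ps a) = ad a.
Proof. by elim: ps a => //= p ps IH a; rewrite IH ad_abuild. Qed.

Lemma ab_abuilds_other ps a x : (forall r, r \in unzip1 ps -> x != blist r) ->
  ab (abuilds ps a) x = ab a x.
Proof.
elim: ps a => //= p ps IH a xps; rewrite IH.
  by apply: ab_abuild_other; apply: xps; rewrite mem_head.
by move=> r rps; apply: xps; rewrite inE rps orbT.
Qed.

Lemma aw_abuilds_other ps a r : r \notin unzip1 ps -> r \notin psources ps ->
  aw (abuilds ps a) r = aw a r.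
Proof.
elim: ps a => //= p ps IH a; rewrite inE negb_or /psources /= mem_cat negb_or.
by move=> /andP[rp rps] /andP[rsp rsps]; rewrite IH // aw_abuild_other.
Qed.

(** All right-hand sides are evaluated in the initial [a]: no build reads a list that another one
    overwrites, since targets are not sources, or empties, since each source is used once. *)
Lemma abuildsP ps a : uniq (unzip1 ps) -> uniq (psources ps) ->
  (forall r, r \in unzip1 ps -> r \notin psources ps) ->
  {in ps, forall p,
    aw (abuilds ps a) p.1 = flatten [seq ival a i | i <- p.2] /\
    ab (abuilds ps a) (blist p.1) = all (idef a) p.2}.
Proof.
elim: ps a => //= p ps IH a /andP[pps ups]; rewrite {1}/psources /= cat_uniq.
move=> /and3P[usp /hasPn dsp usps] dis.
have [psp pps'] : p.1 \notin sources p.2 /\ p.1 \notin psources ps.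
  have := dis p.1; rewrite mem_head /psources /= mem_cat negb_or.
  by move=> /(_ isT)/andP.
move=> p0; rewrite inE => /predU1P[->|p0ps].
  rewrite aw_abuilds_other // ab_abuilds_other; first exact: abuildP.
  by move=> r rps; apply: contraNneq pps => -[->].
have p0ps1 : p0.1 \in unzip1 ps by apply: map_f.
have dis' r : r \in unzip1 ps -> r \notin psources ps.
  move=> rps; have := dis r; rewrite inE rps orbT /psources /= mem_cat negb_or.
  by move=> /(_ isT)/andP[].
have [-> ->] := IH (abuild p.1 p.2 a) ups usps dis' _ p0ps.
have same r : inr r \in p0.2 -> r != p.1 /\ r \notin sources p.2.
  move=> rp0; have rsrc : r \in sources p0.2.
    by rewrite /sources mem_pmap; apply/mapP; exists (inr r).
  have rps : r \in psources ps.
    by apply/flattenP; exists (sources p0.2) => //; apply: map_f.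
  by split; [apply: contraNneq pps' => <- | apply: dsp].
split.
  congr flatten; apply/eq_in_map => -[[g v]|r] ip0 /=; first by rewrite ad_abuild.
  by have [ne ns] := same _ ip0; apply: aw_abuild_other.
apply: eq_in_all => -[[g v]|r] ip0; apply: ab_abuild_other => //.
by have [ne ns] := same _ ip0; apply: contraNneq ne => -[->].
Qed.

Lemma tr_builds w ps a :
  (forall r, r \in unzip1 ps -> r \notin psources ps) ->
  (forall v, ad a (inl v)) ->
  tr w (builds ps) a (abuilds ps a).
Proof.
elim: ps a => [|p ps IH] a dis tot; first exact: tr_skip.
apply: tr_seq (IH (abuild p.1 p.2 a) _ _).
- apply: tr_build => //; have := dis p.1.
  by rewrite mem_head /psources /= mem_cat negb_or => /(_ isT)/andP[].
- move=> r rps; have := dis r; rewrite inE rps orbT /psources /= mem_cat negb_or.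
  by move=> /(_ isT)/andP[].
- by move=> v; rewrite ad_abuild.
Qed.

Definition acopy (src dst : V -> V + V) a v :=
  absb (bdat (dst v)) (ab a (bdat (src v))) (absd (dst v) (ad a (src v)) a).

(** No source is a target, so the order of the copies is irrelevant. A transition may permute data
    variables; passing through the scratch copies brings this about. *)
Lemma acopyP src dst (vs : seq V) a : injective dst ->
  (forall v v', src v != dst v') ->
  let a' := foldl (acopy src dst) a vs in
  [/\ {in vs, forall v, ab a' (bdat (dst v)) = ab a (bdat (src v)) /\
                        ad a' (dst v) = ad a (src v)},
      forall x, (forall v, x != bdat (dst v)) -> ab a' x = ab a x,
      forall y, (forall v, y != dst v) -> ad a' y = ad a y &
      aw a' = aw a].
Proof.
move=> dI sd; rewrite /=.
have other vs' a' : [/\ forall x, (forall v, v \in vs' -> x != bdat (dst v)) ->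
       ab (foldl (acopy src dst) a' vs') x = ab a' x,
    forall y, (forall v, v \in vs' -> y != dst v) ->
       ad (foldl (acopy src dst) a' vs') y = ad a' y &
    aw (foldl (acopy src dst) a' vs') = aw a'].
  elim: vs' a' => [|v vs' IH] a' //=; have [h1 h2 h3] := IH (acopy src dst a' v).
  split=> [x xd|y yd|]; last by rewrite h3.
    rewrite h1 => [|v' v'vs]; last by apply: xd; rewrite inE v'vs orbT.
    by rewrite /= (negbTE (xd _ (mem_head _ _))).
  rewrite h2 => [|v' v'vs]; last by apply: yd; rewrite inE v'vs orbT.
  by rewrite /= (negbTE (yd _ (mem_head _ _))).
have [h1 h2 h3] := other vs a.
split=> // [|x xd|y yd]; [|exact: h1|exact: h2].
elim: vs a {h1 h2 h3} => //= v vs IH a v'; rewrite inE.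
case: (boolP (v' \in vs)) => [v'vs _|v'vs].
  have [-> ->] := IH (acopy src dst a v) _ v'vs.
  have /negbTE sdv : src v' != dst v by apply: sd.
  by rewrite /= sdv ifF //; apply/negP => /eqP[] /eqP; rewrite sdv.
rewrite orbF => /eqP e; rewrite -e.
have [h1 h2 _] := other vs (acopy src dst a v').
have ne y : y \in vs -> v' != y by move=> yvs; apply: contraNneq v'vs => ->.
rewrite h1 ?h2 /= ?eqxx // => y /ne; apply: contraNneq; first by move=> /dI->.
by case=> /dI->.
Qed.

Lemma tr_copy w (src dst : V -> V + V) (vs : seq V) a :
  tr w (block [seq Seq (setd (dat (dst v)) (DVar (dat (src v))))
                       (setb (bdat (dst v)) (BVar (bdat (src v)))) | v <- vs])
    a (foldl (acopy src dst) a vs).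
Proof.
elim: vs a => [|v vs IH] a; first exact: tr_skip.
apply: tr_seq (IH _); apply: tr_seq; first exact: tr_setd.
exact/tr_setb/evals_var.
Qed.

(** * Simulation *)

(** Values whose flag is false are left unconstrained, which makes room for the dummies; so are the
    scratch variables and the output. *)
Definition simulates a (q : Q) (be : valuation Sigma D V X) : Prop :=
  [/\ forall q', ab a (bstate q') = (q' == q),
      forall v, ab a (bdat (inl v)) -> ad a (inl v),
      forall v, vdata be v = if ab a (bdat (inl v)) then ad a (inl v) else None &
      forall x, vstr be x =
        if ab a (blist (strv x)) then Some (aw a (strv x)) else None].

Lemma simulates_pattern a q be (l : pattern Sigma V X) : simulates a q be ->
  eval_pattern be l =
  if all (idef a) (map lift_item l)
  then Some (flatten [seq ival a i | i <- map lift_item l]) else None.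
Proof.
case=> _ dd dv dx; elim: l => //= i l ->.
have -> : eval_item be i =
    if idef a (lift_item i) then Some (ival a (lift_item i)) else None.
  case: i => [[g v]|x] /=; last exact: dx.
  rewrite dv /idef /=; have := dd v.
  by case: (ab a _) => // /(_ isT); case: (ad a _).
by case: (idef a (lift_item i)) => //; case: (all _ _).
Qed.

Lemma evals_all_defined w l a : evals w (all_defined l) a (all (idef a) l).
Proof.
elim: l => [|i l IH]; first exact: evals_const.
by apply: evals_and => //; apply: evals_var.
Qed.

Lemma count_sources (x : X) (l : pattern Sigma V X) :
  count_mem (strv x) (sources (map lift_item l)) = count_mem (inr x) l.
Proof.
elim: l => //= -[[g v]|y] l /=; first by move->.
by move=> ->.
Qed.

Lemma sources_lift r (l : pattern Sigma V X) :
  r \in sources (map lift_item l) -> exists x, r = strv x.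
Proof.
elim: l => //= -[[g v]|y] l IH //=; rewrite inE => /predU1P[->|/IH //].
by exists y.
Qed.

Lemma uniq_count (T : eqType) (s : seq T) :
  (forall x, count_mem x s <= 1) -> uniq s.
Proof.
move=> cs; apply: count_mem_uniq => x; have := cs x.
by rewrite -has_pred1 has_count; case: (count_mem x s) => [|[]].
Qed.

Lemma uniq_sources (ls : seq (pattern Sigma V X)) :
  (forall x, \sum_(p <- ls) count_mem (inr x) p <= 1) ->
  uniq (flatten [seq sources (map lift_item p) | p <- ls]).
Proof.
move=> cl; apply: uniq_count => r.
case: (boolP (r \in flatten [seq sources (map lift_item p) | p <- ls])) => [rs|rs].
  have [p /mapP[p' _ ->] rl] := flattenP rs; have [x ex] := sources_lift rl.
  rewrite ex count_flatten sumnE !big_map (leq_trans _ (cl x)) //.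
  by apply: leq_sum => p0 _; rewrite count_sources.
by rewrite (count_memPn rs).
Qed.

End Effects.

(** * One round of the transducer, and its final output *)

Section Rounds.
Context {disp : Order.disp_t} {D : orderType disp} {Sigma Q V X : finType}.

Local Notation G := (psig_of Q V X).
Local Notation R := (listvar X).
Local Notation item := ((Sigma * V) + R)%type.
Local Notation abs := (@abs disp D Sigma Q V X).
Local Notation transition := (transition Sigma Sigma Q V X).
Implicit Types (a : abs) (r : R) (w : dstring Sigma D) (t : transition).
Implicit Types (q : Q) (be : valuation Sigma D V X).

Definition initialized a : Prop := forall v, ad a (inl v).

Definition copyless t : Prop :=
  forall x, \sum_(y : X) count_mem (inr x) (tstr t y) <= 1.

(** Convertible to [apply_trans], but not tied to a transducer. *)
Definition fire be t : valuation Sigma D V X :=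
  Valuation (fun v => vdata be (tdata t v)) (fun x => eval_pattern be (tstr t x)).

Definition patterns_of t : seq (R * seq item) :=
  [seq (tmpv x, map lift_item (tstr t x)) | x <- enum X].

Definition moves : seq (R * seq item) :=
  [seq (strv x, [:: inr (tmpv x)]) | x <- enum X].

Definition aupdate t a : abs :=
  absb (bstate (tdst t)) true (absb (bstate (tsrc t)) false
    (foldl (acopy inr inl) (foldl (acopy (inl \o tdata t) inr)
      (abuilds moves (abuilds (patterns_of t) a)) (enum V)) (enum V))).

Lemma patterns_ofP t : copyless t ->
  [/\ uniq (unzip1 (patterns_of t)), uniq (psources (patterns_of t)) &
      forall r, r \in unzip1 (patterns_of t) -> r \notin psources (patterns_of t)].
Proof.
move=> ct; have unE : unzip1 (patterns_of t) = [seq tmpv x | x <- enum X].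
  by rewrite /unzip1 -map_comp.
have srcE : psources (patterns_of t) =
    flatten [seq sources (map lift_item p) | p <- [seq tstr t x | x <- enum X]].
  by rewrite /psources -!map_comp.
rewrite unE srcE; split; first by rewrite map_inj_uniq ?enum_uniq // => x y [].
  by apply: uniq_sources => x; rewrite big_map big_enum.
move=> _ /mapP[x _ ->]; apply/negP => /flattenP[l /mapP[p _ ->]].
by move=> /sources_lift[y].
Qed.

Lemma movesP : [/\ uniq (unzip1 moves), uniq (psources moves) &
  forall r, r \in unzip1 moves -> r \notin psources moves].
Proof.
have unE : unzip1 moves = [seq strv x | x <- enum X] by rewrite /unzip1 -map_comp.
have srcE : psources moves = [seq tmpv x | x <- enum X].
  by rewrite /psources /moves -map_comp; elim: (enum X) => //= x xs ->.
have uX := enum_uniq X.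
rewrite unE srcE; split; [by rewrite map_inj_uniq // => x y []..|].
by move=> _ /mapP[x _ ->]; apply/negP => /mapP[].
Qed.

Lemma tr_update w t a : copyless t -> initialized a -> tr w (update t) a (aupdate t a).
Proof.
move=> ct ta; have [_ _ dis1] := patterns_ofP ct; have [_ _ dis2] := movesP.
apply: tr_seq; first exact: (tr_builds dis1).
apply: tr_seq; first by apply: (tr_builds dis2) => v; rewrite ad_abuilds.
apply: tr_seq; first exact: (@tr_copy _ _ _ _ _ _ _ (inl \o tdata t) inr).
apply: tr_seq; first exact: (@tr_copy _ _ _ _ _ _ _ inr inl).
apply: tr_seq; first exact/tr_setb/evals_const.
apply: tr_seq; first exact/tr_setb/evals_const.
exact: tr_skip.
Qed.

Lemma aupdateP t a be : copyless t -> initialized a -> simulates a (tsrc t) be ->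
  simulates (aupdate t a) (tdst t) (fire be t) /\ initialized (aupdate t a).
Proof.
move=> ct ta sim; have [u1 u2 u3] := patterns_ofP ct; have [v1 v2 v3] := movesP.
have [st dd dv dx] := sim.
rewrite /aupdate; set a1 := abuilds (patterns_of t) a; set a2 := abuilds moves a1.
have ad2 : ad a2 = ad a by rewrite !ad_abuilds.
have ab2 x : (forall r, x != blist r) -> ab a2 x = ab a x.
  by move=> xr; rewrite !ab_abuilds_other.
have [c1 c2 c3 c4] := @acopyP _ D Sigma Q V X (inl \o tdata t) inr (enum V) a2
  (@inr_inj _ _) (fun _ _ => isT).
set a3 := foldl _ a2 _ in c1 c2 c3 c4 *.
have [e1 e2 e3 e4] := @acopyP _ D Sigma Q V X inr inl (enum V) a3
  (@inl_inj _ _) (fun _ _ => isT).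
set a4 := foldl _ a3 _ in e1 e2 e3 e4 *.
have dat4 v : ab a4 (bdat (inl v)) = ab a (bdat (inl (tdata t v))) /\
              ad a4 (inl v) = ad a (inl (tdata t v)).
  have [-> ->] := e1 v (mem_enum _ _); have [-> ->] := c1 v (mem_enum _ _).
  by rewrite ad2 ab2.
have list4 x : ab a4 (blist (strv x)) = all (idef a) (map lift_item (tstr t x)) /\
    aw a4 (strv x) = flatten [seq ival a i | i <- map lift_item (tstr t x)].
  rewrite e2 // c2 // e4 c4.
  have mx : (strv x, [:: inr (tmpv x)]) \in moves.
    by apply/mapP; exists x; rewrite ?mem_enum.
  have px : (tmpv x, map lift_item (tstr t x)) \in patterns_of t.
    by apply/mapP; exists x; rewrite ?mem_enum.
  have /= [-> ->] := abuildsP a1 v1 v2 v3 mx; rewrite cats0 andbT /idef /=.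
  by have /= [-> ->] := abuildsP a u1 u2 u3 px.
split; last by move=> v /=; case: (dat4 v) => _ ->.
split=> [q'|v|v|x] /=.
- rewrite -[bstate q' == bstate _]/(q' == tdst t).
  rewrite -[bstate q' == bstate _]/(q' == tsrc t).
  case: (eqVneq q' (tdst t)) => [//|ne].
  case: eqP => [//|ne']; rewrite e2 // c2 // ab2 // st.
  by apply/eqP.
- by case: (dat4 v) => -> ->; apply: dd.
- by case: (dat4 v) => -> ->; rewrite dv.
- by case: (list4 x) => -> ->; rewrite (simulates_pattern _ sim).
Qed.

Lemma simulates_read curr q be a d : simulates a q be ->
  simulates (absb (bdat (inl curr)) true (absd (inl curr) (Some d) a)) q
    (set_curr curr be d).
Proof.
case=> st dd dv dx; split=> [q'|v|v|x] //=.
- rewrite -[bdat _ == bdat _]/(v == curr) -[inl v == inl curr]/(v == curr).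
  by case: eqP => // _; apply: dd.
- rewrite -[bdat _ == bdat _]/(v == curr) -[inl v == inl curr]/(v == curr).
  by case: eqP.
Qed.

(** Every variable holds a value, dummy or not, so both translations evaluate without error; if [b1]
    is false then [b2] may depend on dummies. *)
Lemma evals_test w curr q be a phi :
  simulates a q be -> initialized a -> ab a (bdat (inl curr)) ->
  exists b1 b2, [/\ evals w (test_defined phi) a b1,
    evals w (test_holds curr phi) a b2 &
    eval_test curr (vdata be) phi = if b1 then Some b2 else None].
Proof.
move=> [_ _ dv _] ta dc.
have evlt v1 v2 d1 d2 : ad a (inl v1) = Some d1 -> ad a (inl v2) = Some d2 ->
    evals w (BDataLt (DVar (dat (inl v1))) (DVar (dat (inl v2)))) a (d1 < d2)%O.
  by move=> e1 e2 m h s [_ _ rd _] /=; rewrite /eval_dcmp /= !rd e1 e2.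
have [c ec] : exists c, ad a (inl curr) = Some c.
  by have := ta curr; case: (ad a _) => // c; exists c.
elim: phi => [||v|v|p [b1 [b2 [e1 e2 e3]]]|
    p [b1 [b2 [e1 e2 e3]]] p' [b1' [b2' [e1' e2' e3']]]|
    p [b1 [b2 [e1 e2 e3]]] p' [b1' [b2' [e1' e2' e3']]]].
- by exists true, true; split.
- by exists true, false; split.
- have [d ed] : exists d, ad a (inl v) = Some d.
    by have := ta v; case: (ad a _) => // d; exists d.
  exists (ab a (bdat (inl v))), (d < c)%O; split; [exact: evals_var|exact: evlt|].
  by rewrite /= !dv dc ec ed; case: (ab _ _).
- have [d ed] : exists d, ad a (inl v) = Some d.
    by have := ta v; case: (ad a _) => // d; exists d.
  exists (ab a (bdat (inl v))), (c < d)%O; split; [exact: evals_var|exact: evlt|].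
  by rewrite /= !dv dc ec ed; case: (ab _ _).
- exists b1, (~~ b2); split=> //; first exact: evals_not.
  by rewrite /= e3; case: (b1).
- exists (b1 && b1'), (b2 && b2'); split; [exact: evals_and|exact: evals_and|].
  by rewrite /= e3 e3'; case: (b1); case: (b1').
- exists (b1 && b1'), (b2 || b2'); split; [exact: evals_and|exact: evals_or|].
  by rewrite /= e3 e3'; case: (b1); case: (b1').
Qed.

Definition enabled curr q be (sigma : Sigma) t : bool :=
  [&& tsrc t == q, ttag t == sigma &
      eval_test curr (vdata be) (ttest t) == Some true].

Lemma evals_guard p w curr q be a t :
  simulates a q be -> initialized a -> ab a (bdat (inl curr)) ->
  evals (p :: w) (guard curr t) a (enabled curr q be p.1 t).
Proof.
move=> sim ta dc; have [b1 [b2 [e1 e2 e3]]] := evals_test (p :: w) (ttest t) sim ta dc.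
have -> : enabled curr q be p.1 t =
    (tsrc t == q) && ((p.1 == ttag t) && (b1 && b2)).
  by rewrite /enabled e3 (eq_sym p.1); case: b1 b2 {e1 e2 e3} => -[].
have [st _ _ _] := sim; rewrite -st.
apply: evals_and; first exact: evals_var.
apply: evals_and; last exact: evals_and.
by move=> m h s ra; rewrite /= (rep_curr ra).
Qed.

(** The cascade fires the first enabled transition of the list. Its uniqueness enters later, when it
    is matched with the transition of a given run. *)
Lemma rulesP p w curr q be a (ts : seq transition) :
  (forall t, List.In t ts -> copyless t) ->
  simulates a q be -> initialized a -> ab a (bdat (inl curr)) ->
  (exists t, [/\ List.In t ts, enabled curr q be p.1 t &
                 tr (p :: w) (rules curr ts) a (aupdate t a)]) \/
  ((forall t, List.In t ts -> ~~ enabled curr q be p.1 t) /\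
   trcrash (p :: w) (rules curr ts) a).
Proof.
move=> cts sim ta dc; elim: ts cts => [|t ts IH] cts.
  by right; split=> //; apply: trcrash_fail.
have eg := @evals_guard p w curr q be a t sim ta dc.
case: (boolP (enabled curr q be p.1 t)) => [en|nen].
  left; exists t; split=> //; first by left.
  by apply: tr_ifelse eg _; rewrite en; apply: tr_update (cts _ _) ta; left.
have [|[t' [t'ts en t'tr]]|[nen' cr]] := IH; first by move=> t' ?; apply: cts; right.
  left; exists t'; split=> //; first by right.
  by apply: tr_ifelse eg _; rewrite (negbTE nen).
right; split; first by move=> t' [<-|/nen'].
by apply: trcrash_ifelse eg _; rewrite (negbTE nen).
Qed.

Lemma rep_advance m p w h s a : rep m (p :: w) h s a ->
  exists h' s', runs (Assign Advance) h s h' s' /\ rep m w h' s' a.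
Proof.
move=> ra; have cur := rep_curr ra; case: ra => [[i [im mh hi si]] rb rd rl].
exists h, (set_cval s (if w is [::] then None else Some i.+1)); split.
  by apply: runs_assign; rewrite /= cur si /=; case: (w).
split=> //; exists i.+1; split=> //; first by rewrite addSnnS.
by case: p hi {im cur} => t d [].
Qed.

Lemma finishP a q be (out : {ffun Q -> option (pattern Sigma V X)}) :
  (forall q s, out q = Some s -> forall x, count_mem (inr x) s <= 1) ->
  simulates a q be ->
  match obind (eval_pattern be) (out q) with
  | Some w' => exists a', tr [::] (finish out) a a' /\ aw a' outv = w'
  | None => trcrash [::] (finish out) a
  end.
Proof.
move=> cout sim; rewrite /finish.
set k := finish_at out.
(* Generalized to suffixes of the enumeration: without [q], no state flag of the suffix holds and
   the cascade reaches [fail]. Uniqueness provides this for the part after [q], where a failed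
   definedness test ends up. *)
suff tail l : uniq l ->
    if q \in l then
      match obind (eval_pattern be) (out q) with
      | Some w' => exists a', tr [::] (foldr k fail l) a a' /\ aw a' outv = w'
      | None => trcrash [::] (foldr k fail l) a
      end
    else trcrash [::] (foldr k fail l) a.
  by have := tail _ (enum_uniq Q); rewrite mem_enum.
have [st dd _ _] := sim.
elim: l => [|q' l IH] /=; first by move=> _; apply: trcrash_fail.
move=> /andP[q'l /IH{}IH]; rewrite inE.
have ev s : evals [::] (BAnd (BVar (bstate q')) (all_defined (map lift_item s))) a
    (ab a (bstate q') && all (idef a) (map lift_item s)).
  by apply: evals_and; [exact: evals_var | exact: evals_all_defined].
case: (eqVneq q q') => [eq|ne] /=.
  subst q'; rewrite (negbTE q'l) in IH.
  case Eo: (out q) => [s|] /=; last first.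
    by rewrite /k /finish_at Eo.
  have {ev} := ev s; rewrite st eqxx /= (simulates_pattern _ sim) => ev.
  have -> st' : k q st' = IfThenElse
      (BAnd (BVar (bstate q)) (all_defined (map lift_item s)))
      (build outv (map lift_item s)) st' by rewrite /k /finish_at Eo.
  case Ed: (all _ _) in ev *; last exact: trcrash_ifelse ev IH.
  exists (abuild outv (map lift_item s) a).
  have nout : outv \notin sources (map lift_item s).
    by apply/negP => /sources_lift[].
  have usrc : uniq (sources (map lift_item s)).
    apply: uniq_count => r; case: (boolP (r \in sources (map lift_item s))) => [rs|rs].
      have [x ->] := sources_lift rs; rewrite count_sources; exact: cout Eo _.
    by rewrite (count_memPn rs).
  split; last by have [-> _] := abuildP a nout usrc.
  apply: tr_ifelse ev _; apply: tr_build => // g v gvs.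
  by apply: dd; have /allP/(_ _ gvs) := Ed.
have cr : forall st', trcrash [::] st' a -> trcrash [::] (k q' st') a.
  move=> st' c; rewrite /k /finish_at; case Eo: (out q') => [s|//].
  by apply: trcrash_ifelse (ev s) _; rewrite st eq_sym (negbTE ne).
case: (q \in l) IH => [|IH]; last exact: cr.
case: (obind _ _) => [w' [a' [t e]]|IH]; last exact: cr.
exists a'; split=> //; rewrite /k /finish_at; case Eo: (out q') => [s|//].
by apply: tr_ifelse (ev s) _; rewrite st eq_sym (negbTE ne).
Qed.

End Rounds.

(** * Layout of the initial heap *)

Section InputHeap.
Context {disp : Order.disp_t} {D : orderType disp} {Sigma : finType}.

(** For the induction, an arbitrary prefix [h] is already laid out, while [n] remains the total
    length that decides which node is last. *)
Lemma input_at_cat n (h : heap Sigma D) (w : dstring Sigma D) :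
  size h + size w = n ->
  input_at (h ++ [seq Cell x.1.1 x.1.2 (if x.2 < n then Some x.2 else None)
                 | x <- zip w (iota (size h).+1 (size w))]) (size h) w.
Proof.
elim: w h => //= -[t d] w IH h hn; split.
  rewrite onth_cat ltnn subnn -hn /=; case: (w) => [|p w'] /=.
    by rewrite addn1 ltnn.
  by rewrite addnS ltnS addnS ltnS leq_addr.
rewrite -cat_rcons; set c := Cell _ _ _.
have szc : size (rcons h c) = (size h).+1 by rewrite size_rcons.
by rewrite -szc; apply: IH; rewrite szc addSnnS.
Qed.

Lemma input_at_input_heap (w : dstring Sigma D) : input_at (input_heap w) 0 w.
Proof. exact: (@input_at_cat _ [::]). Qed.

Lemma size_input_heap (w : dstring Sigma D) : size (input_heap w) = size w.
Proof. by rewrite size_map size_zip size_iota minnn. Qed.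

End InputHeap.

(** * Equality of the two semantics *)

Section Correctness.
Context {disp : Order.disp_t} {D : orderType disp} {Sigma : finType}.
Variable S : sdst D Sigma Sigma.

Local Notation Q := (state S).
Local Notation V := (datavar S).
Local Notation X := (strvar S).
Local Notation G := (psig_of Q V X).
Local Notation abs := (@abs disp D Sigma Q V X).
Implicit Types (a : abs) (w : dstring Sigma D) (q : Q) (be : sdst_val S).

Lemma trans_copyless_in t : List.In t (trans S) -> copyless t.
Proof. exact: trans_copyless. Qed.

Lemma sdst_run_cons p w q be q' be' (be1 := set_curr (curr S) be p.2) :
  sdst_run q be (p :: w) q' be' <->
  exists t, [/\ List.In t (trans S), enabled (curr S) q be1 p.1 t &
                sdst_run (tdst t) (apply_trans be1 t) w q' be'].
Proof.
case: p @be1 => sigma d be1; split=> [run|[t [tS /and3P[/eqP <- /eqP tg /eqP ev] run]]].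
  inversion run as [|be0 sigma0 d0 w0 t q1 be2 tS tg ev run']; subst.
  by exists t; split=> //; rewrite /enabled !eqxx ev /=.
exact: RunCons tS tg ev run.
Qed.

Lemma enabled_inj q be sigma t1 t2 :
  List.In t1 (trans S) -> List.In t2 (trans S) ->
  enabled (curr S) q be sigma t1 -> enabled (curr S) q be sigma t2 -> t1 = t2.
Proof.
move=> t1S t2S /and3P[/eqP s1 /eqP g1 /eqP e1] /and3P[/eqP s2 /eqP g2 /eqP e2].
(* [trans_deterministic] only speaks of distinct transitions, hence a classical argument. *)
apply: NNPP => ne.
by case: (trans_deterministic t1S t2S ne _ _ (b := vdata be)); rewrite ?s1 ?g1.
Qed.

Lemma sdst_run_inj w q be q1 be1 q2 be2 :
  sdst_run q be w q1 be1 -> sdst_run q be w q2 be2 -> q1 = q2 /\ be1 = be2.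
Proof.
elim: w q be => [|p w IH] q be r1 r2.
  by inversion r1; inversion r2; subst.
have /sdst_run_cons[t1 [t1S e1 r1']] := r1.
have /sdst_run_cons[t2 [t2S e2 r2']] := r2.
by rewrite (enabled_inj t2S t1S e2 e1) in r2'; apply: IH r1' r2'.
Qed.

Lemma evals_unfinished w a : evals w (BNot at_end) a (~~ nilp w).
Proof. by apply: evals_not; apply: evals_at_end. Qed.

Definition round : stmt Sigma G :=
  block [:: read_curr (curr S); rules (curr S) (trans S); Assign Advance].

Lemma runs_while_true e st (h : heap Sigma D) (s : store Sigma D G) h1 s1 h2 s2 :
  eval_bexp h s e = Some true -> runs st h s h1 s1 ->
  runs (While e st) h1 s1 h2 s2 -> runs (While e st) h s h2 s2.
Proof.
move=> E r1 r2 k; apply: reaches_step; first by rewrite /= E.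
exact: reaches_trans (r1 _) (r2 _).
Qed.

Lemma runs_while_false e st (h : heap Sigma D) (s : store Sigma D G) :
  eval_bexp h s e = Some false -> runs (While e st) h s h s.
Proof.
by move=> E k; apply: reaches_step _ (reaches_refl _); rewrite /= E.
Qed.

Lemma crashes_while e st (h : heap Sigma D) (s : store Sigma D G) :
  eval_bexp h s e = Some true -> crashes (Seq st (While e st)) h s ->
  crashes (While e st) h s.
Proof.
move=> E cr k; have [c [rc hc lc]] := cr k; exists c; split=> //.
(* The run to [c] takes at least one step, because [c] is stuck and [Seq] is not, and that step only
   unfolds [Seq]. *)
have {rc} : reaches (Config [:: st, While e st & k] h s) c.
  case: rc => -[[ec]|n].
    by rewrite -ec in hc.
  by rewrite iterSr /= => rn; exists n.
by apply: reaches_step; rewrite /= E.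
Qed.

(** [initialized] is required for nonempty [w] only: on the empty input there is no data value to
    serve as a dummy. In the second alternative, program and transducer get stuck on the same
    symbol. *)
Lemma loopP m w q be h s a :
  rep m w h s a -> simulates a q be -> (w <> [::] -> initialized a) ->
  (exists q' be' h' s' a',
     [/\ sdst_run q be w q' be', runs (loop (curr S) (trans S)) h s h' s',
         rep m [::] h' s' a' & simulates a' q' be']) \/
  ((forall q' be', ~ sdst_run q be w q' be') /\
   crashes (loop (curr S) (trans S)) h s).
Proof.
elim: w q be h s a => [|p w IH] q be h s a ra sim ta.
  left; exists q, be, h, s, a; split=> //; first exact: RunNil.
  exact/runs_while_false/(evals_unfinished ra).
have {}ta : initialized a by apply: ta.
have guard : eval_bexp h s (BNot at_end) = Some true.
  exact: (evals_unfinished ra).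
pose a1 := absb (bdat (inl (curr S))) true (absd (inl (curr S)) (Some p.2) a).
pose be1 := set_curr (curr S) be p.2.
have sim1 : simulates a1 q be1 by apply: simulates_read.
have ta1 : initialized a1 by move=> v /=; case: eqP => // _; apply: ta.
have dc1 : ab a1 (bdat (inl (curr S))) by rewrite /= eqxx.
have tr1 : tr (p :: w) (read_curr (curr S)) a a1.
  apply: tr_seq; first exact: tr_setd_curr.
  exact/tr_setb/evals_const.
have [h1 [s1 [r1 ra1]]] := tr1 _ _ _ ra.
have [[t [tS en t2]]|[nen cr]] :=
    rulesP p w trans_copyless_in sim1 ta1 dc1; last first.
  right; split.
    by move=> q' be' /sdst_run_cons[t [tS en _]]; case/negP: (nen t tS).
  apply: crashes_while guard _; apply: crashes_seq.
  exact/(runs_crashes r1)/crashes_seq/(cr _ _ _ ra1).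
have [h2 [s2 [r2 ra2]]] := t2 _ _ _ ra1.
have [h3 [s3 [r3 ra3]]] := rep_advance ra2.
have rr : runs round h s h3 s3.
  apply: runs_seq r1 _; apply: runs_seq r2 _; apply: runs_seq r3 _.
  exact: runs_if_false.
have tq : tsrc t = q by case/and3P: en => /eqP.
rewrite -tq in sim1.
have [sim2 ta2] := aupdateP (trans_copyless_in tS) ta1 sim1.
have [] := IH _ _ _ _ _ ra3 sim2 (fun=> ta2).
  move=> [q' [be' [h' [s' [a' [run rl ra' sim']]]]]]; left.
  exists q', be', h', s', a'; split=> //; last exact: runs_while_true guard rr rl.
  by apply/sdst_run_cons; exists t.
move=> [norun cr]; right; split.
  move=> q' be' /sdst_run_cons[t' [t'S en' run']].
  by apply: (norun q' be'); rewrite -(enabled_inj t'S tS en' en).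
apply: crashes_while guard _; exact: runs_crashes rr cr.
Qed.

Definition abs0 : abs := Abs (fun=> false) (fun=> None) (fun=> [::]).

Lemma setupP w : exists a, [/\ tr w (setup (start S)) abs0 a,
  simulates a (start S) init_valuation & w <> [::] -> initialized a].
Proof.
pose a1 := absb (bstate (start S)) true abs0.
pose mark a x : abs := absb (blist (strv x)) true a.
pose a2 := foldl mark a1 (enum X).
have [ab2 ad2 aw2] : [/\ forall y, ab a2 y =
    (y \in [seq blist (strv x) | x <- enum X]) || ab a1 y,
    ad a2 =1 fun=> None & aw a2 =1 fun=> [::]].
  rewrite /a2; have : [/\ ad a1 =1 fun=> None & aw a1 =1 fun=> [::]] by [].
  elim: (enum X) a1 {a2} => [a1 [d1 w1]|x l IH a1 [d1 w1] /=]; first by split.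
  have [//|ab2 ad2 aw2] := IH (mark a1 x).
  split=> // y; rewrite ab2 /= inE.
  by case: (y == blist (strv x)); rewrite ?orbT.
have sim2 : simulates a2 (start S) init_valuation.
  split=> [q'|v|v|x].
  - rewrite ab2 /=; case: mapP => [[]//|_] /=.
    by rewrite -[bstate q' == bstate _]/(q' == start S); case: eqP.
  - by rewrite ab2 /=; case: mapP => [[]|].
  - by rewrite ab2 /=; case: mapP => [[]|].
  - by rewrite ab2 aw2 (map_f (fun x => blist (strv x))) ?mem_enum.
have tr3 a3 : tr w (IfThen (BNot at_end)
      (block [seq setd (dat (inl v)) (DataOf RCurr) | v <- enum V])) a2 a3 ->
    tr w (setup (start S)) abs0 a3.
  move=> t3; apply: tr_seq; first exact/tr_setb/evals_const.
  apply: tr_seq.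
    apply: (tr_block_map (F := fun x a => mark a x)) => x a.
    exact/tr_setb/evals_const.
  by apply: tr_seq t3 _; apply: tr_skip.
case: w tr3 => [|p w] tr3.
  exists a2; split=> //; apply: tr3.
  by apply: tr_if (@evals_unfinished _ _) _.
pose init a v : abs := absd (inl v) (Some p.2) a.
pose a3 := foldl init a2 (enum V).
have [ad3 ab3 aw3] : [/\ forall v, ad a3 (inl v) =
    if v \in enum V then Some p.2 else ad a2 (inl v), ab a3 = ab a2 & aw a3 = aw a2].
  rewrite /a3; elim: (enum V) a2 {a3 tr3 ab2 ad2 aw2 sim2} => //= v l IH a2.
  have [ad3 -> ->] := IH (init a2 v); split=> // v'; rewrite ad3 /= inE.
  by rewrite -[inl v' == inl v]/(v' == v); case: (v' == v); case: (v' \in l).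
exists a3; split.
- apply: tr3; apply: tr_if (@evals_unfinished _ _) _.
  apply: (tr_block_map (F := fun v a => init a v)) => v a.
  exact: tr_setd_curr.
- case: sim2 => st dd dv dx; split=> [q'|v|v|x]; rewrite ?ab3 ?aw3 //.
    by move=> _; rewrite ad3 mem_enum.
  by rewrite ab2 /=; case: mapP => [[]|].
- by move=> _ v; rewrite ad3 mem_enum.
Qed.

Lemma rep_init (ins : @inputs _ D Sigma (program_of S)) w :
  rep (size w) w (input_heap w) (init_store ins w) abs0.
Proof.
split=> [|x|x|] /=.
- exists 0; split=> //; first by rewrite size_input_heap.
  exact: input_at_input_heap.
- by rewrite ffunE.
- by rewrite ffunE.
- by exists (fun=> [::]); split=> //= r; rewrite ffunE.
Qed.

Lemma sdst_sem_inj w w1 w2 : sdst_sem S w w1 -> sdst_sem S w w2 -> w1 = w2.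
Proof.
move=> [q1 [be1 [s1 [r1 o1 e1]]]] [q2 [be2 [s2 [r2 o2 e2]]]].
have [eq ebe] := sdst_run_inj r1 r2; subst q2 be2.
by move: o2; rewrite o1 => -[es]; move: e2; rewrite -es e1 => -[].
Qed.

(** This dichotomy contains both directions of correctness: since the final configuration and the
    output of the transducer are unique, it determines both partial functions. *)
Lemma program_runs (ins : @inputs _ D Sigma (program_of S)) w :
  (exists w' h s, [/\ sdst_sem S w w', reaches (init_config ins w) (Config [::] h s)
     & list_at h (rval s (prout (program_of S))) w']) \/
  ((forall w', ~ sdst_sem S w w') /\
   exists c, [/\ reaches (init_config ins w) c, step c = None & location c <> [::]]).
Proof.
have [a [tr1 sim1 init1]] := setupP w.
have [h1 [s1 [r1 ra1]]] := tr1 _ _ _ (rep_init ins w).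
have [[q [be [h2 [s2 [a2 [run r2 ra2 sim2]]]]]]|[norun cr]] := loopP ra1 sim1 init1;
    last first.
  right; split; first by move=> w' [q [be [u [/norun]]]].
  exact: (runs_crashes r1 (crashes_seq _ cr)).
have := finishP (@output_copyless _ _ _ _ S) sim2.
case Eo: (obind _ _) => [w'|] fin.
  have [a3 [t3 ew']] := fin; have [h3 [s3 [r3 ra3]]] := t3 _ _ _ ra2.
  left; exists w', h3, s3; split.
  - case Es: (output S q) Eo => [u|//] Eo; exists q, be, u; split=> //.
  - apply: (runs_seq r1 (runs_seq r2 (runs_seq r3 _))); exact: runs_if_false.
  - have [_ _ _ [ns [l1 _ _ _ _]]] := ra3.
    by rewrite -ew'; apply: lseg_list_at (l1 outv).
right; split.
  move=> w' [q' [be' [u [run' o e]]]].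
  have [eq ebe] := sdst_run_inj run run'; subst q' be'.
  by rewrite o /= e in Eo.
exact: (runs_crashes r1 (runs_crashes r2 (crashes_seq _ (fin _ _ _ ra2)))).
Qed.

Lemma program_of_correct (E : io_encoding D Sigma) w w' :
  sdst_sem S w w' <-> program_sem E (program_of S) w w'.
Proof.
have none (T : finType) (p : pred T) : p =1 xpred0 -> [seq x <- enum T | p x] = [::].
  by move/eq_filter->; apply: filter_pred0.
have no_in ins : enc_inputs E (P := program_of S) ins = [::].
  rewrite /enc_inputs none => [|x]; last by rewrite ffunE.
  rewrite none => [|[]//].
  by rewrite none // => x; rewrite ffunE.
have no_out s : enc_outputs E (P := program_of S) s = [::].
  rewrite /enc_outputs none => [|x]; last by rewrite ffunE.
  rewrite none => [|[]//].
  by rewrite none // => x; rewrite ffunE.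
split=> [sem|].
  pose ins : @inputs _ D Sigma (program_of S) :=
    @Inputs _ D Sigma (program_of S) (fun=> false)
      (fun x : void => match x with end) (fun=> None).
  have [[w1 [h [s [sem1 run l]]]]|[nosem _]] := program_runs ins w; last first.
    by case: (nosem _ sem).
  rewrite (sdst_sem_inj sem sem1).
  by exists ins, [::], w, [::], w1, h, s; split.
move=> [ins [pre [u [post [v [h [s [[-> pre0] run l [-> post0]]]]]]]]].
move: pre0 post0; rewrite no_in no_out; case: pre => // _; case: post => // _ /=.
have [[w1 [h1 [s1 [sem run1 l1]]]]|[_ [c [rc hc lc]]]] := program_runs ins u.
  have [eh es] : Config [::] h s = Config [::] h1 s1 by apply: reaches_halt_inj run run1.
  by subst h1 s1; rewrite (list_at_inj l l1).
have ec : Config [::] h s = c by apply: reaches_halt_inj run rc.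
by rewrite -ec in lc.
Qed.

End Correctness.

(** * The compiler *)

Definition selT (i : nat) (t : tree) : tree := lchild (iter i rchild t).

Lemma computable_selT i f : computable f -> computable (fun p => selT i (f p)).
Proof.
move=> cf; apply: computable_lchild; elim: i => //= i; exact: computable_rchild.
Qed.

Lemma computable_cons0 k : computable (fun=> code_cons k [::]).
Proof. exact: computable_const. Qed.

Lemma computable_cons1 k f : computable f ->
  computable (fun p => code_cons k [:: f p]).
Proof. by rewrite /code_cons /=; comp. Qed.

Lemma computable_cons2 k f g : computable f -> computable g ->
  computable (fun p => code_cons k [:: f p; g p]).
Proof. by rewrite /code_cons /=; comp. Qed.

Lemma computable_cons3 k f g h : computable f -> computable g -> computable h ->
  computable (fun p => code_cons k [:: f p; g p; h p]).
Proof. by rewrite /code_cons /=; comp. Qed.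

Lemma computable_cons4 k f g h i :
  computable f -> computable g -> computable h -> computable i ->
  computable (fun p => code_cons k [:: f p; g p; h p; i p]).
Proof. by rewrite /code_cons /=; comp. Qed.

#[local] Hint Resolve computable_selT computable_cons0 computable_cons1
  computable_cons2 computable_cons3 computable_cons4 : comp.

(* Positions in [code_sdst] and, from [srcT] on, in [code_transition]. *)
Local Notation nstate := (selT 2).
Local Notation startT := (selT 3).
Local Notation ndat := (selT 4).
Local Notation currT := (selT 5).
Local Notation nstr := (selT 6).
Local Notation outputT := (selT 7).
Local Notation transT := (selT 8).
Local Notation srcT := (selT 0).
Local Notation tagT := (selT 1).
Local Notation testT := (selT 2).
Local Notation dstT := (selT 3).
Local Notation dataT := (selT 4).
Local Notation strT := (selT 5).

(** Numbers of the variables of the generated program, given the code [e] of the transducer. Left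
    injections keep their number, which is why [rfirst], [bstate] and current data variables have no
    counterpart here. *)
Definition tmpvT (x : tree) := Node Leaf x.
Definition strvT (e x : tree) := Node Leaf (addT (nstr e) x).
Definition scratchT (e v : tree) := addT (ndat e) v.
Definition bdatT (e y : tree) := addT (nstate e) y.
Definition blistT (e r : tree) :=
  addT (nstate e) (addT (addT (ndat e) (ndat e)) r).
Definition rlastT (e r : tree) := addT (Node Leaf (addT (nstr e) (nstr e))) r.

Definition failT : tree :=
  code_cons 0 [:: code_cons 4 [:: code_cons 0 [::]; code_cons 1 [::]]].
Definition trueT : tree := code_cons 0 [:: code_bool true].
Definition falseT : tree := code_cons 0 [:: code_bool false].
Definition skipT : tree := code_cons 2 [:: falseT; failT].
Definition seqT (s1 s2 : tree) := code_cons 1 [:: s1; s2].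
Definition nilT : tree := code_cons 1 [::].
Definition currpT : tree := code_cons 0 [::].
Definition bvarT (x : tree) := code_cons 1 [:: x].
Definition andT (b1 b2 : tree) := code_cons 7 [:: b1; b2].
Definition dvarT (x : tree) := code_cons 0 [:: x].
Definition rexpT (x : tree) := code_cons 0 [:: code_cons 1 [:: x]].
Definition isnilT (r : tree) := code_cons 5 [:: r; nilT].
Definition setbT (x b : tree) := code_cons 0 [:: code_cons 0 [:: x; b]].
Definition setdT (x d : tree) := code_cons 0 [:: code_cons 2 [:: x; d]].
Definition setrT (x r : tree) := code_cons 0 [:: code_cons 3 [:: x; r]].
Definition ifT (b s : tree) := code_cons 2 [:: b; s].
Definition ifelseT (b s1 s2 : tree) := code_cons 3 [:: b; s1; s2].

Definition clearT (e r : tree) :=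
  seqT (setrT r nilT) (seqT (setrT (rlastT e r) nilT)
    (seqT (setbT (blistT e r) trueT) skipT)).

Definition pushT (e r g v : tree) :=
  seqT (code_cons 0 [:: code_cons 5
         [:: r; code_cons 1 [:: g]; dvarT v; rexpT r]])
  (seqT (ifT (isnilT (rexpT (rlastT e r))) (setrT (rlastT e r) (rexpT r)))
  (seqT (setbT (blistT e r) (andT (bvarT (blistT e r)) (bvarT (bdatT e v))))
  skipT)).

Definition prependT (e r r' : tree) :=
  seqT (ifT (code_cons 6 [:: isnilT (rexpT r')])
    (seqT (ifT (isnilT (rexpT (rlastT e r)))
               (setrT (rlastT e r) (rexpT (rlastT e r'))))
    (seqT (code_cons 0 [:: code_cons 4
            [:: code_cons 1 [:: rlastT e r']; rexpT r]])
    (seqT (setrT r (rexpT r'))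
    (seqT (setrT r' nilT)
    (seqT (setrT (rlastT e r') nilT) skipT))))))
  (seqT (setbT (blistT e r) (andT (bvarT (blistT e r)) (bvarT (blistT e r'))))
  skipT).

Definition itemT (i : tree) := lchild (rchild i).

(** [lchild i] is the constructor number: zero, read as false, for a tagged data variable, and one
    for a string variable. *)
Definition push_itemT (e r i : tree) :=
  condT (lchild i) (prependT e r (strvT e (itemT i)))
    (pushT e r (lchild (itemT i)) (rchild (itemT i))).

Definition buildT (e r s : tree) :=
  foldT (fun p => clearT (lchild p) (rchild p))
    (fun p i acc => seqT acc (push_itemT (lchild p) (rchild p) i)) (Node e r) s.

Definition bdefinedT (e i : tree) :=
  condT (lchild i) (blistT e (strvT e (itemT i))) (bdatT e (rchild (itemT i))).

Definition all_definedT (e s : tree) :=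
  foldT (fun=> trueT) (fun e i acc => andT (bvarT (bdefinedT e i)) acc) e s.

(* On [code_cons k args], [f] receives [code_nat k], the list [args] and the
   list of the results on [args]: the recursion computes, for each subtree, the
   result when it is read as a constructor and when it is read as a list. *)
Definition cons_recT_both (f : tree -> tree -> tree -> tree -> tree) :=
  recT (fun=> Node Leaf Leaf) (fun e l r resl resr =>
    Node (f e l r (rchild resr)) (Node (lchild resl) (rchild resr))).

Definition cons_recT f e t := lchild (cons_recT_both f e t).

(** Case analysis by table: all branches are computed, which is harmless for total functions, and
    the constructor number selects one. *)
Definition test_definedT :=
  cons_recT (fun e k args res => nthT (code_seq id
    [:: trueT; trueT; bvarT (bdatT e (selT 0 args)); bvarT (bdatT e (selT 0 args));
        selT 0 res; andT (selT 0 res) (selT 1 res);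
        andT (selT 0 res) (selT 1 res)]) k).

Definition test_holdsT :=
  cons_recT (fun e k args res => nthT (code_seq id
    [:: trueT; falseT;
        code_cons 4 [:: dvarT (selT 0 args); dvarT (currT e)];
        code_cons 4 [:: dvarT (currT e); dvarT (selT 0 args)];
        code_cons 6 [:: selT 0 res]; andT (selT 0 res) (selT 1 res);
        code_cons 8 [:: selT 0 res; selT 1 res]]) k).

Definition guardT (e t : tree) :=
  andT (bvarT (srcT t))
    (andT (code_cons 2 [:: code_cons 2 [:: currpT]; code_cons 1 [:: tagT t]])
      (andT (test_definedT e (testT t)) (test_holdsT e (testT t)))).

Definition block_mapT (body : tree -> tree -> tree) :=
  foldT (fun=> skipT) (fun e x acc => seqT (body e x) acc).

Definition copyT (e src dst : tree) :=
  seqT (setdT dst (dvarT src)) (setbT (bdatT e dst) (bvarT (bdatT e src))).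

Definition updateT (e t : tree) :=
  seqT (block_mapT (fun p x => buildT (lchild p) (tmpvT x) (nthT (strT (rchild p)) x))
         (Node e t) (iotaT (nstr e)))
  (seqT (block_mapT (fun e x => seqT (clearT e (strvT e x))
                                     (prependT e (strvT e x) (tmpvT x)))
          e (iotaT (nstr e)))
  (seqT (block_mapT (fun p v => copyT (lchild p) (nthT (dataT (rchild p)) v)
                                      (scratchT (lchild p) v))
          (Node e t) (iotaT (ndat e)))
  (seqT (block_mapT (fun e v => copyT e (scratchT e v) v) e (iotaT (ndat e)))
  (seqT (setbT (srcT t) falseT) (seqT (setbT (dstT t) trueT) skipT))))).

Definition rulesT (e ts : tree) :=
  foldT (fun=> failT) (fun e t => ifelseT (guardT e t) (updateT e t)) e ts.

Definition curr_dataT : tree := code_cons 1 [:: currpT].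

Definition unfinishedT : tree := code_cons 6 [:: isnilT (code_cons 0 [:: currpT])].

Definition loopT (e : tree) :=
  code_cons 4 [:: unfinishedT;
    seqT (seqT (setdT (currT e) curr_dataT) (setbT (bdatT e (currT e)) trueT))
    (seqT (rulesT e (transT e))
    (seqT (code_cons 0 [:: code_cons 6 [::]]) skipT))].

Definition finishT (e : tree) :=
  foldT (fun=> failT) (fun e q acc =>
    condT (nthT (outputT e) q)
      (ifelseT (andT (bvarT q) (all_definedT e (lchild (nthT (outputT e) q))))
               (* [Leaf] is the number of [outv], that is, of [None]. *)
               (buildT e Leaf (lchild (nthT (outputT e) q))) acc)
      acc) e (iotaT (nstate e)).

Definition setupT (e : tree) :=
  seqT (setbT (startT e) trueT)
  (seqT (block_mapT (fun e x => setbT (blistT e (strvT e x)) trueT)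
          e (iotaT (nstr e)))
  (seqT (ifT unfinishedT
          (block_mapT (fun e v => setdT v curr_dataT) e (iotaT (ndat e))))
  skipT)).

Definition bodyT (e : tree) :=
  seqT (setupT e) (seqT (loopT e) (seqT (finishT e) skipT)).

Definition nlistT (e : tree) := Node Leaf (addT (nstr e) (nstr e)).
Definition nboolT (e : tree) :=
  addT (nstate e) (addT (addT (ndat e) (ndat e)) (nlistT e)).

(** The entries [Leaf] stand for the number of tag variables, their empty declaration table and the
    rank of [rfirst outv]. The other declaration tables are constant. *)
Definition compile (e : tree) : tree := code_seq id
  [:: nboolT e; Leaf; addT (ndat e) (ndat e); addT (nlistT e) (nlistT e);
      nseqT (code_cons 2 [:: code_cons 0 [:: code_bool false]]) (nboolT e); Leaf;
      nseqT (code_cons 2 [:: Leaf]) (addT (ndat e) (ndat e));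
      nseqT (code_cons 1 [::]) (addT (nlistT e) (nlistT e));
      Leaf; bodyT e].

(** * Computability of the compiler *)

Lemma computable_strvT e x : computable e -> computable x ->
  computable (fun p => strvT (e p) (x p)).
Proof. by rewrite /strvT; comp. Qed.

Lemma computable_scratchT e v : computable e -> computable v ->
  computable (fun p => scratchT (e p) (v p)).
Proof. by rewrite /scratchT; comp. Qed.

Lemma computable_bdatT e y : computable e -> computable y ->
  computable (fun p => bdatT (e p) (y p)).
Proof. by rewrite /bdatT; comp. Qed.

Lemma computable_blistT e r : computable e -> computable r ->
  computable (fun p => blistT (e p) (r p)).
Proof. by rewrite /blistT; comp. Qed.

Lemma computable_rlastT e r : computable e -> computable r ->
  computable (fun p => rlastT (e p) (r p)).
Proof. by rewrite /rlastT; comp. Qed.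

#[local] Hint Resolve computable_bdatT computable_blistT computable_rlastT
  computable_strvT computable_scratchT : comp.

Ltac unfoldT := rewrite /seqT /setrT /setdT /setbT /ifT /ifelseT /isnilT /rexpT
  /andT /bvarT /dvarT /tmpvT /itemT.

Lemma computable_clearT e r : computable e -> computable r ->
  computable (fun p => clearT (e p) (r p)).
Proof. by rewrite /clearT; unfoldT; comp. Qed.

Lemma computable_pushT e r g v :
  computable e -> computable r -> computable g -> computable v ->
  computable (fun p => pushT (e p) (r p) (g p) (v p)).
Proof. by rewrite /pushT; unfoldT; comp. Qed.

Lemma computable_prependT e r r' :
  computable e -> computable r -> computable r' ->
  computable (fun p => prependT (e p) (r p) (r' p)).
Proof. by rewrite /prependT; unfoldT; comp. Qed.

#[local] Hint Resolve computable_clearT computable_pushT computable_prependT : comp.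

Lemma computable_buildT e r s : computable e -> computable r -> computable s ->
  computable (fun p => buildT (e p) (r p) (s p)).
Proof.
by move=> ce cr cs; apply: computable_foldT; rewrite /push_itemT; unfoldT; comp.
Qed.

Lemma computable_all_definedT e s : computable e -> computable s ->
  computable (fun p => all_definedT (e p) (s p)).
Proof.
by move=> ce cs; apply: computable_foldT; rewrite /bdefinedT; unfoldT; comp.
Qed.

Lemma computable_cons_recT f e t :
  (forall e k args res, computable e -> computable k -> computable args ->
    computable res -> computable (fun p => f (e p) (k p) (args p) (res p))) ->
  computable e -> computable t -> computable (fun p => cons_recT f (e p) (t p)).
Proof. by move=> cf ce ct; apply/computable_lchild/computable_recT; comp. Qed.

Lemma computable_guardT e t : computable e -> computable t ->
  computable (fun p => guardT (e p) (t p)).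
Proof.
move=> ce ct; have c1 : computable (fun p => test_definedT (e p) (testT (t p))).
  apply: computable_cons_recT; comp => e' k args res ce' ck cargs cres.
  by rewrite /code_seq /=; unfoldT; comp.
have c2 : computable (fun p => test_holdsT (e p) (testT (t p))).
  apply: computable_cons_recT; comp => e' k args res ce' ck cargs cres.
  by rewrite /code_seq /=; unfoldT; comp.
by rewrite /guardT; unfoldT; comp.
Qed.

Lemma computable_block_mapT body e s :
  (forall e x, computable e -> computable x ->
    computable (fun p => body (e p) (x p))) ->
  computable e -> computable s ->
  computable (fun p => block_mapT body (e p) (s p)).
Proof.
by move=> cb ce cs; apply: computable_foldT; unfoldT; comp.
Qed.

#[local] Hint Resolve computable_buildT computable_all_definedT
  computable_guardT computable_block_mapT : comp.

Lemma computable_updateT e t : computable e -> computable t ->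
  computable (fun p => updateT (e p) (t p)).
Proof.
by move=> ce ct; rewrite /updateT /copyT; unfoldT; comp.
Qed.

#[local] Hint Resolve computable_updateT : comp.

Lemma computable_compile : computable compile.
Proof.
have crules e : computable e ->
    computable (fun p => foldT (fun=> failT)
      (fun e t => ifelseT (guardT e t) (updateT e t)) (e p) (transT (e p))).
  by move=> ce; apply: computable_foldT; unfoldT; comp.
have cfinish : computable finishT by apply: computable_foldT; unfoldT; comp.
rewrite /compile /bodyT /loopT /setupT /rulesT /nboolT /nlistT /code_seq /=.
by unfoldT; comp.
Qed.

Lemma cons_recT_cons f e k args :
  cons_recT f e (code_cons k args) =
  f e (code_nat k) (code_seq id args) (code_seq (cons_recT f e) args).
Proof.
rewrite [LHS]/=; congr f; elim: args => //= x args IH.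
by congr Node.
Qed.


(** * Agreement of the compiler with the program text *)

Section CompilerCode.
Context {Sigma Q V X : finType}.
Variable e : tree.
Hypotheses (eQ : nstate e = code_nat #|Q|) (eV : ndat e = code_nat #|V|).
Hypothesis eX : nstr e = code_nat #|X|.

Local Notation G := (psig_of Q V X).
Local Notation R := (listvar X).
Local Notation stmt := (stmt Sigma G).
Implicit Types (r : R) (v : V) (x : X).

Lemma code_tmpv x : code_elt (tmpv x) = tmpvT (code_elt x).
Proof. by rewrite code_elt_Some code_elt_inl. Qed.

Lemma code_strv x : code_elt (strv x) = strvT e (code_elt x).
Proof. by rewrite code_elt_Some code_elt_inr /strvT eX. Qed.

Lemma code_scratch v : code_elt (inr v : V + V) = scratchT e (code_elt v).
Proof. by rewrite code_elt_inr /scratchT eV. Qed.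

Lemma code_bdat y : code_elt (bdat y : bvar G) = bdatT e (code_elt y).
Proof. by rewrite code_elt_inr code_elt_inl /bdatT eQ. Qed.

Lemma code_blist r : code_elt (blist r : bvar G) = blistT e (code_elt r).
Proof.
by rewrite code_elt_inr code_elt_inr card_sum /blistT eQ eV addT_code.
Qed.

Lemma code_rlast r : code_elt (rlast r : rvar G) = rlastT e (code_elt r).
Proof.
by rewrite code_elt_inr card_option card_sum /rlastT eX addT_code.
Qed.

Lemma code_rfirst r : code_elt (rfirst r : rvar G) = code_elt r.
Proof. exact: code_elt_inl. Qed.

Lemma code_bstate q : code_elt (bstate q : bvar G) = code_elt q.
Proof. exact: code_elt_inl. Qed.

Let codeE := (code_tmpv, code_strv, code_scratch, code_bdat, code_blist,
  code_rlast, code_rfirst, code_bstate).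

Lemma code_clear r : code_stmt (clear r : stmt) = clearT e (code_elt r).
Proof. by rewrite /= !codeE. Qed.

Lemma code_push r g v : code_stmt (push r g v : stmt) =
  pushT e (code_elt r) (code_elt g) (code_elt v).
Proof. by rewrite /= !codeE code_elt_inl. Qed.

Lemma code_prepend r r' : code_stmt (prepend r r' : stmt) =
  prependT e (code_elt r) (code_elt r').
Proof. by rewrite /= !codeE. Qed.

Lemma code_build r (s : pattern Sigma V X) :
  code_stmt (build r (map lift_item s) : stmt) = buildT e (code_elt r) (code_pattern s).
Proof.
rewrite /buildT foldT_code_seq; elim: s => [|i s IH]; first exact: code_clear.
rewrite [foldr _ _ _]/= -IH.
rewrite -[LHS]/(seqT (code_stmt (build r (map lift_item s)))
  (code_stmt (push_item r (lift_item i)))).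
congr seqT; case: i => [[g v]|x]; first exact: code_push.
by rewrite [LHS]code_prepend code_strv.
Qed.

Lemma code_all_defined (s : pattern Sigma V X) :
  code_bexp (all_defined (map lift_item s) : bexp Sigma G) =
  all_definedT e (code_pattern s).
Proof.
rewrite /all_definedT foldT_code_seq; elim: s => //= i s ->.
congr andT; case: i => [[g v]|x] /=; by rewrite !codeE ?code_elt_inl.
Qed.

Lemma code_test_defined (phi : test V) :
  code_bexp (test_defined phi : bexp Sigma G) = test_definedT e (code_test phi).
Proof.
elim: phi => [||v|v|p IH|p IHp q IHq|p IHp q IHq];
  rewrite /test_definedT cons_recT_cons.
- by [].
- by [].
- by rewrite /= codeE code_elt_inl.
- by rewrite /= codeE code_elt_inl.
- by rewrite [LHS]IH.
- by rewrite [LHS]/= IHp IHq.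
- by rewrite [LHS]/= IHp IHq.
Qed.

Lemma code_test_holds (curr : V) (phi : test V) : currT e = code_elt curr ->
  code_bexp (test_holds curr phi : bexp Sigma G) = test_holdsT e (code_test phi).
Proof.
move=> ec.
elim: phi => [||v|v|p IH|p IHp q IHq|p IHp q IHq];
  rewrite /test_holdsT cons_recT_cons.
- by [].
- by [].
- by rewrite /= !code_elt_inl -ec.
- by rewrite /= !code_elt_inl -ec.
- by rewrite [LHS]/= IH.
- by rewrite [LHS]/= IHp IHq.
- by rewrite [LHS]/= IHp IHq.
Qed.

Lemma code_block_map (T : finType) body env (f : T -> stmt) :
  (forall y, code_stmt (f y) = body env (code_elt y)) ->
  code_stmt (block [seq f y | y <- enum T]) = block_mapT body env (iotaT (code_nat #|T|)).
Proof.
move=> fb; rewrite iotaT_enum /block_mapT foldT_code_seq.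
by elim: (enum T) => //= y s ->; rewrite fb.
Qed.

Lemma code_guard curr (t : transition Sigma Sigma Q V X) : currT e = code_elt curr ->
  code_bexp (guard curr t : bexp Sigma G) = guardT e (code_transition t).
Proof.
by move=> ec; rewrite /= code_bstate code_test_defined (code_test_holds _ ec).
Qed.

Lemma code_update (t : transition Sigma Sigma Q V X) :
  code_stmt (update t : stmt) = updateT e (code_transition t).
Proof.
rewrite /updateT eX eV.
(* Each fold over [iotaT] is turned back into a block of statements; the side conditions on the loop
   bodies come afterwards, in reverse order. *)
rewrite -(@code_block_map X _ _ (fun x => build (tmpv x) (map lift_item (tstr t x)))).
  rewrite -(@code_block_map X _ _ (fun x => build (strv x) [:: inr (tmpv x)])).
    rewrite -(@code_block_map V _ _ (fun v =>
      Seq (setd (dat (inr v)) (DVar (dat (inl (tdata t v)))))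
          (setb (bdat (inr v)) (BVar (bdat (inl (tdata t v))))))).
      rewrite -(@code_block_map V _ _ (fun v =>
        Seq (setd (dat (inl v)) (DVar (dat (inr v))))
            (setb (bdat (inl v)) (BVar (bdat (inr v)))))).
        rewrite /update /builds -!map_comp.
        rewrite -[srcT _]/(code_elt (tsrc t)) -[dstT _]/(code_elt (tdst t)).
        by rewrite -(code_bstate (tsrc t)) -(code_bstate (tdst t)).
      by move=> v; rewrite /= /copyT !codeE code_elt_inl.
    move=> v; rewrite /= /copyT !codeE code_elt_inl.
    by rewrite [nthT _ _]nthT_code_fun.
  move=> x; rewrite -[LHS]/(seqT (code_stmt (clear _)) (code_stmt (prepend _ _))).
  by rewrite code_clear code_prepend !codeE.
move=> x; rewrite code_build code_tmpv; congr buildT.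
exact/esym/nthT_code_fun.
Qed.

Lemma code_rules curr (ts : seq (transition Sigma Sigma Q V X)) :
  currT e = code_elt curr ->
  code_stmt (rules curr ts : stmt) = rulesT e (code_seq (@code_transition _ _ _ _ _) ts).
Proof.
move=> ec; rewrite /rulesT foldT_code_seq; elim: ts => // t ts IH.
rewrite -[LHS]/(ifelseT (code_bexp (guard curr t)) (code_stmt (update t))
  (code_stmt (rules curr ts))).
by rewrite IH code_update (code_guard _ ec).
Qed.

Lemma code_loop curr (ts : seq (transition Sigma Sigma Q V X)) :
  currT e = code_elt curr -> transT e = code_seq (@code_transition _ _ _ _ _) ts ->
  code_stmt (loop curr ts : stmt) = loopT e.
Proof.
move=> ec et; rewrite /loopT et ec -(code_rules _ ec).
by rewrite /= code_bdat !code_elt_inl.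
Qed.

Lemma code_finish (out : {ffun Q -> option (pattern Sigma V X)}) :
  outputT e = code_fun (code_option (@code_pattern Sigma V X)) out ->
  code_stmt (finish out : stmt) = finishT e.
Proof.
move=> eo; rewrite /finishT eQ iotaT_enum foldT_code_seq /finish.
elim: (enum Q) => // q s IH; rewrite [foldr _ _ _]/= [in RHS]/= -IH.
rewrite eo nthT_code_fun /finish_at; case: (out q) => [p|] //=.
by rewrite code_bstate code_all_defined [in LHS]code_build code_elt_None.
Qed.

Lemma code_setup q0 : startT e = code_elt q0 ->
  code_stmt (setup q0 : stmt) = setupT e.
Proof.
move=> es; rewrite /setupT es eX eV.
rewrite -(@code_block_map X _ _ (fun x => setb (blist (strv x)) (BConst true))).
  rewrite -(@code_block_map V _ _ (fun v => setd (dat (inl v)) (DataOf RCurr))).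
    by rewrite /= code_bstate.
  by move=> v; rewrite /= code_elt_inl.
by move=> x; rewrite /= !codeE.
Qed.

End CompilerCode.

Lemma compile_code {disp : Order.disp_t} {D : orderType disp} {Sigma : finType}
    (S : sdst D Sigma Sigma) :
  compile (code_sdst S) = code_program (program_of S).
Proof.
set e := code_sdst S.
have eQ : nstate e = code_nat #|state S| by [].
have eV : ndat e = code_nat #|datavar S| by [].
have eX : nstr e = code_nat #|strvar S| by [].
have body : bodyT e = code_stmt (body_of S).
  rewrite /bodyT -(@code_setup Sigma _ _ _ e eQ eV eX (start S)) //.
  rewrite -(@code_loop Sigma _ _ _ e eQ eV eX (curr S) (trans S)) //.
  by rewrite -(@code_finish Sigma _ _ _ e eQ eV eX (output S)).
have const (T : finType) A (f : A -> tree) (c : A) (g : T -> A) : g =1 (fun=> c) ->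
    code_fun f g = nseqT (f c) (code_nat #|T|).
  move=> gc; rewrite cardE nseqT_code /code_fun.
  by elim: (enum T) => //= x s ->; rewrite gc.
have nlist : nlistT e = code_nat #|listvar (strvar S)|.
  by rewrite /nlistT eX addT_code card_option card_sum.
have nbool : nboolT e = code_nat #|bvar (psig (program_of S))|.
  by rewrite /nboolT nlist eQ eV !addT_code !card_sum.
rewrite /compile /code_program body nbool nlist eV !addT_code.
rewrite (const _ _ _ (Local (inl false)) (bdecl _)); last by move=> x; rewrite ffunE.
rewrite (const _ _ _ (Local None) (ddecl _)); last by move=> x; rewrite ffunE.
rewrite (const _ _ _ InitNil (rdecl _)); last by move=> x; rewrite ffunE.
have out0 : code_elt (prout (program_of S)) = Leaf.
  by rewrite [LHS]code_elt_inl code_elt_None.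
have no_tag A (f : A -> tree) g : code_fun (T := void) f g = Leaf.
  rewrite /code_fun (_ : enum {: void} = [::]) //.
  by apply: size0nil; rewrite -cardE card_void.
by rewrite out0 no_tag card_void !card_sum.
Qed.

Theorem proposition7 (disp : Order.disp_t) (D : orderType disp) :
  exists compiler : algorithm,
    forall (Sigma : finType) (S : sdst D Sigma Sigma),
      exists P : program Sigma,
        computes compiler (code_sdst S) (code_program P) /\
        (forall (E : io_encoding D Sigma) (w w' : dstring Sigma D),
            sdst_sem S w w' <-> program_sem E P w w').
Proof.
have [compiler cP] := computable_compile.
exists compiler => Sigma S; exists (program_of S); split.
  by rewrite -compile_code.
by move=> E w w'; apply: program_of_correct.
Qed.
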